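(* Let $P:\mathcal{M}(\mathbb{C})^N\to\mathcal{M}(\mathbb{C})^N$ be a free polynomial map. The following are equivalent: (1) For every $n$ and every $X\in\mathcal{M}_n(\mathbb{C})^N$, the linear map $H\mapsto DP(X)[H]$ on $\mathcal{M}_n(\mathbb{C})^N$ is nonsingular (i.e. $DP(X)[H]=0$ implies $H=0$). (2) $P$ is injective. (3) $P$ is bijective. (4) $P^{-1}$ exists and, for each $n$, $P^{-1}|_{\mathcal{M}_n(\mathbb{C})^N}$ agrees with (the evaluation of) some free polynomial map.
   Context: $\mathcal{M}_n(\mathbb{C})$ denotes the $n\times n$ complex matrices and $\mathcal{M}(\mathbb{C})^N=\bigcup_{n\ge1}\mathcal{M}_n(\mathbb{C})^N$. A free polynomial map $P=(p_1,\dots,p_N)$ is an $N$-tuple of noncommutative polynomials in $N$ variables with complex coefficients, evaluated on matrix tuples by substitution; it maps $\mathcal{M}_n(\mathbb{C})^N$ to itself. The derivative $DP(X)[H]$, for $X,H\in\mathcal{M}_n(\mathbb{C})^N$, is defined by $P\begin{pmatrix}X&H\\0&X\end{pmatrix}=\begin{pmatrix}P(X)&DP(X)[H]\\0&P(X)\end{pmatrix}$ (block matrices formed coordinatewise); equivalently it is the evaluation of the formal derivative obtained from $D(x_i)[H]=H_i$, linearity, and the Leibniz rule $D(fg)[H]=Df[H]g+fDg[H]$. *)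

(* Defs.v *)
From HB Require Import structures.
From mathcomp Require Import all_boot all_order all_algebra.
Set Implicit Arguments. Unset Strict Implicit. Unset Printing Implicit Defensive.
Import Order.TTheory GRing.Theory Num.Theory.
Local Open Scope ring_scope.

(* Noncommutative polynomials in N variables x_0,...,x_{N-1} with coefficients
   in C, represented as formal expressions (elements of the free algebra are
   only used through their evaluations on matrix tuples). *)
Inductive ncpoly (C : Type) (N : nat) : Type :=
  | NCVar of 'I_N
  | NCConst of C
  | NCAdd of ncpoly C N & ncpoly C N
  | NCMul of ncpoly C N & ncpoly C N.

Section Eval.
Variables (C : numClosedFieldType) (N n : nat).

Fixpoint nceval (X : {ffun 'I_N -> 'M[C]_n}) (p : ncpoly C N) : 'M[C]_n :=
  match p with
  | NCVar i => X i
  | NCConst c => c%:M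
  | NCAdd p q => nceval X p + nceval X q
  | NCMul p q => nceval X p * nceval X q
  end.

Fixpoint ncderiv (X H : {ffun 'I_N -> 'M[C]_n}) (p : ncpoly C N) : 'M[C]_n :=
  match p with
  | NCVar i => H i
  | NCConst _ => 0
  | NCAdd p q => ncderiv X H p + ncderiv X H q
  | NCMul p q => ncderiv X H p * nceval X q + nceval X p * ncderiv X H q
  end.
End Eval.

Definition fpmap (C : numClosedFieldType) (N : nat) := 'I_N -> ncpoly C N.

Definition fpeval (C : numClosedFieldType) (N : nat) (P : fpmap C N) (n : nat)
  (X : {ffun 'I_N -> 'M[C]_n}) : {ffun 'I_N -> 'M[C]_n} :=
  [ffun i => nceval X (P i)].

Definition fpderiv (C : numClosedFieldType) (N : nat) (P : fpmap C N) (n : nat)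
  (X H : {ffun 'I_N -> 'M[C]_n}) : {ffun 'I_N -> 'M[C]_n} :=
  [ffun i => ncderiv X H (P i)].

(* Main.v *)
(** Write P(X) - P(Y) = J(X, Y)(X - Y), where J(X, Y)H is the upper right block of P at
    [[X, H], [0, Y]].  Evaluating at block matrices shows that (1) and (2) both say that
    J(X, Y) is invertible for all X, Y; then det J, a nowhere vanishing polynomial in the
    entries of X and Y, is a nonzero constant c, and
        c (X - Y) = adj J(X, Y) (P(X) - P(Y))
    holds over every commutative ring.  P has a noncommutative formal inverse with
    homogeneous parts g_k; one shows that g_k vanishes on n x n matrices for k > M, with M
    the number of monomials in the entries of adj J, so that the sum of the g_k with
    k <= M is the inverse on n x n matrices.

    If g_k did not vanish, one could specialize all coefficients involved to a finite field
    F, keeping c and one entry of g_k(Y) nonzero.  Over F let X(t) = sum_k g_k(Y) t^k, so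
    that P(X(t)) = P(0) + tY.  The identity above at (X(t), X(t')) factors the Hankel matrix
    of the coefficients of X through M dimensions, hence h X is a polynomial of degree at
    most M for some nonzero h in F[t].  On tuples over the finite ring F[t]/(h^D) the map P
    is injective, hence onto, which gives a polynomial x' with P(x') = P(0) + tY mod h^D;
    then c (X - x') = adj J(X, x') (P(X) - P(x')), and for large D the factor h^D clears the
    denominators of adj J(X, x').  So X is a polynomial, of degree at most M. *)

Require Import Defs.
From HB Require Import structures.
From mathcomp Require Import all_boot all_order all_algebra all_field.
From mathcomp Require Import ring zify mpoly.
From Stdlib Require Import Classical.
Set Implicit Arguments. Unset Strict Implicit. Unset Printing Implicit Defensive.
Import GRing.Theory Num.Theory.
Local Open Scope ring_scope.

(** * Evaluation and difference quotients of noncommutative polynomials *)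

Section Evaluation.
Variables (R : comNzRingType) (N n : nat).
Implicit Types (X Y H K : 'I_N -> 'M[R]_n) (p q : ncpoly R N).

Fixpoint ev X p : 'M[R]_n :=
  match p with
  | NCVar i => X i
  | NCConst c => c%:M
  | NCAdd p q => ev X p + ev X q
  | NCMul p q => ev X p *m ev X q
  end.

(* The upper right block of the value at [[X, H], [0, Y]]; the choice H = X - Y
   gives the difference of the values, and X = Y the derivative. *)
Fixpoint dd X Y H p : 'M[R]_n :=
  match p with
  | NCVar i => H i
  | NCConst _ => 0
  | NCAdd p q => dd X Y H p + dd X Y H q
  | NCMul p q => dd X Y H p *m ev Y q + ev X p *m dd X Y H q
  end.

Lemma eq_ev X Y p : X =1 Y -> ev X p = ev Y p.
Proof. by move=> e; elim: p => //= p -> q ->. Qed.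

Lemma eq_dd X X' Y Y' H H' p :
  X =1 X' -> Y =1 Y' -> H =1 H' -> dd X Y H p = dd X' Y' H' p.
Proof.
by move=> eX eY eH; elim: p => //= p -> q -> //; rewrite (eq_ev _ eX) (eq_ev _ eY).
Qed.

(** On products the terms telescope: [(p(X) - p(Y)) q(Y) + p(X) (q(X) - q(Y))]. *)
Lemma dd_sub X Y p : dd X Y (fun i => X i - Y i) p = ev X p - ev Y p.
Proof.
elim: p => [i|c|p IHp q IHq|p IHp q IHq] /=; rewrite ?subrr //.
  by rewrite IHp IHq addrACA opprD.
by rewrite IHp IHq mulmxBl mulmxBr addrC addrA subrK.
Qed.

Lemma dd_linear X Y a H K p :
  dd X Y (fun i => a *: H i + K i) p = a *: dd X Y H p + dd X Y K p.
Proof.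
elim: p => [i|c|p IHp q IHq|p IHp q IHq] //=; first by rewrite scaler0 addr0.
  by rewrite IHp IHq scalerDr addrACA.
by rewrite IHp IHq mulmxDl mulmxDr -scalemxAl -scalemxAr scalerDr addrACA.
Qed.

Lemma dd0 X Y p : dd X Y (fun _ => 0) p = 0.
Proof.
by elim: p => //= p -> q ->; rewrite ?addr0 // mul0mx mulmx0 addr0.
Qed.

Lemma dd_sum (I : Type) (r : seq I) X Y (a : I -> R) (H : I -> 'I_N -> 'M_n) p :
  dd X Y (fun i => \sum_(s <- r) a s *: H s i) p =
  \sum_(s <- r) a s *: dd X Y (H s) p.
Proof.
elim: r => [|s r IHr].
  by rewrite big_nil -[RHS](dd0 X Y p); apply: eq_dd => // i; rewrite big_nil.
rewrite big_cons -IHr -dd_linear.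
by apply: eq_dd => // i; rewrite big_cons.
Qed.

End Evaluation.

Lemma ev_block (R : comNzRingType) (N n : nat) (X Y H : 'I_N -> 'M[R]_n) (p : ncpoly R N) :
  ev (fun i => block_mx (X i) (H i) 0 (Y i)) p =
  block_mx (ev X p) (dd X Y H p) 0 (ev Y p).
Proof.
elim: p => [i|c|p IHp q IHq|p IHp q IHq] //=.
- by rewrite scalar_mx_block.
- by rewrite IHp IHq add_block_mx addr0.
- rewrite IHp IHq mulmx_block !mulmx0 !mul0mx !addr0 add0r.
  by rewrite [ev X p *m dd _ _ _ _ + _]addrC.
Qed.

(** The operator at the pair [X], [Y] is a corner of the derivative at the direct sum of [X] and
    [Y], so condition (1) in size [n + n] controls [dd X Y] in size [n]. *)
Lemma dd_block (R : comNzRingType) (N n : nat) (X Y H : 'I_N -> 'M[R]_n)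
    (p : ncpoly R N) :
  let XY i := block_mx (X i) 0 0 (Y i) in
  dd XY XY (fun i => block_mx 0 (H i) 0 0) p = block_mx 0 (dd X Y H p) 0 0.
Proof.
move=> XY.
have evXY q : ev XY q = block_mx (ev X q) 0 0 (ev Y q).
  by rewrite (ev_block X Y (fun _ => 0)) dd0.
elim: p => [i|c|p IHp q IHq|p IHp q IHq] //=; first by rewrite block_mx0.
  by rewrite IHp IHq add_block_mx !addr0.
by rewrite IHp IHq !evXY !mulmx_block !mulmx0 !mul0mx !addr0 !add0r add_block_mx !addr0.
Qed.

Fixpoint ncmap (R S : Type) (N : nat) (f : R -> S) (p : ncpoly R N) : ncpoly S N :=
  match p with
  | NCVar i => NCVar S i
  | NCConst c => NCConst N (f c)
  | NCAdd p q => NCAdd (ncmap f p) (ncmap f q)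
  | NCMul p q => NCMul (ncmap f p) (ncmap f q)
  end.

Section Naturality.
Variables (R S : comNzRingType) (f : {rmorphism R -> S}) (N n : nat).

Lemma ev_map (X : 'I_N -> 'M[R]_n) p :
  ev (fun i => map_mx f (X i)) (ncmap f p) = map_mx f (ev X p).
Proof.
elim: p => [i|c|p IHp q IHq|p IHp q IHq] //=; first by rewrite map_scalar_mx.
  by rewrite IHp IHq map_mxD.
by rewrite IHp IHq map_mxM.
Qed.

Lemma dd_map (X Y H : 'I_N -> 'M[R]_n) p :
  dd (fun i => map_mx f (X i)) (fun i => map_mx f (Y i))
     (fun i => map_mx f (H i)) (ncmap f p) = map_mx f (dd X Y H p).
Proof.
elim: p => [i|c|p IHp q IHq|p IHp q IHq] //=; first by rewrite map_mx0.
  by rewrite IHp IHq map_mxD.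
by rewrite IHp IHq !ev_map map_mxD !map_mxM.
Qed.

End Naturality.

Lemma ncmap_comp (R S T : Type) (N : nat) (f : R -> S) (g : S -> T) (p : ncpoly R N) :
  ncmap g (ncmap f p) = ncmap (g \o f) p.
Proof. by elim: p => //= p -> q ->. Qed.

Lemma eq_ncmap (R S : Type) (N : nat) (f g : R -> S) (p : ncpoly R N) :
  f =1 g -> ncmap f p = ncmap g p.
Proof. by move=> e; elim: p => //= [c|p -> q ->|p -> q ->] //; rewrite e. Qed.

(** * Polynomial functions and polynomials *)

Section Mmap.
Variables (k : nat) (R : comNzRingType).
Implicit Types p : {mpoly R[k]}.

Lemma eq_mmap (S : comNzRingType) (f g : R -> S) (h h' : 'I_k -> S) p :
  f =1 g -> h =1 h' -> mmap f h p = mmap g h' p.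
Proof.
by move=> ef eh; apply: eq_bigr => m _; rewrite ef (mmap1_eq m eh).
Qed.

Lemma rmorph_mmap (S T : comNzRingType) (g : {rmorphism S -> T})
    (f : {rmorphism R -> S}) (h : 'I_k -> S) p :
  g (mmap f h p) = mmap (g \o f) (g \o h) p.
Proof.
rewrite rmorph_sum; apply: eq_bigr => m _; rewrite rmorphM rmorph_prod.
by congr (_ * _); apply: eq_bigr => i _; rewrite rmorphXn.
Qed.

Lemma mmap_map (S T : comNzRingType) (g : {rmorphism R -> S}) (f : {rmorphism S -> T})
    (h : 'I_k -> T) p :
  mmap f h (map_mpoly g p) = mmap (f \o g) h p.
Proof.
rewrite /map_mpoly (rmorph_mmap (mmap f h) (@mpolyC k S \o g)).
by apply: eq_mmap => [c|i] /=; rewrite ?mmapC // mmapX mmap1U.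
Qed.

End Mmap.

(** In characteristic 0 the integers below [size q] are distinct roots, one more than a nonzero [q]
    can have. *)
Lemma poly_vanish (K : fieldType) (q : {poly K}) :
  [pchar K] =i pred0 -> (forall t, q.[t] = 0) -> q = 0.
Proof.
move=> /pcharf0P charK q0; apply/eqP/negP => /negP nz.
pose rs := [seq i%:R : K | i <- iota 0 (size q)].
have : (size rs < size q)%N.
  apply: max_poly_roots nz _ _; first by apply/allP => x _; rewrite /root q0.
  rewrite map_inj_in_uniq ?iota_uniq // => i j _ _ /eqP.
  wlog le_ij : i j / (i <= j)%N => [th|].
    by case: (leqP i j) => [/th//|/ltnW/th e]; rewrite eq_sym => /e.
  rewrite eq_sym -subr_eq0 -natrB // charK subn_eq0 => le_ji.
  by apply/eqP; rewrite eqn_leq le_ij.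
by rewrite size_map size_iota ltnn.
Qed.

(** Uniqueness of digits in base [B]: remainder and quotient by [B] split off the lowest digit. *)
Lemma sum_expn_inj (B k : nat) (f g : 'I_k -> nat) :
  (forall i, f i < B)%N -> (forall i, g i < B)%N ->
  (\sum_i f i * B ^ i = \sum_i g i * B ^ i)%N -> f =1 g.
Proof.
elim: k f g => [|k IHk] f g fB gB; first by move=> _ [].
have step (u : 'I_k.+1 -> nat) : (\sum_i u i * B ^ i =
    (\sum_(i < k) u (lift ord0 i) * B ^ i) * B + u ord0)%N.
  rewrite big_ord_recl expn0 muln1 addnC big_distrl; congr (_ + _)%N.
  by apply: eq_bigr => i _; rewrite expnSr mulnA.
rewrite !step => e.
have B_gt0 : (0 < B)%N by apply: leq_ltn_trans (fB ord0).
have e0 : f ord0 = g ord0.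
  by move: (congr1 (modn^~ B) e); rewrite !modnMDl !modn_small.
have /IHk er : (\sum_(i < k) f (lift ord0 i) * B ^ i =
    \sum_(i < k) g (lift ord0 i) * B ^ i)%N.
  by move: (congr1 (divn^~ B) e); rewrite !divnMDl // !divn_small // !addn0.
by move=> i; case: (unliftP ord0 i) => [j|] ->; rewrite ?e0 // er.
Qed.

Lemma mpoly_vanish (K : fieldType) (k : nat) (p : {mpoly K[k]}) :
  [pchar K] =i pred0 -> (forall v, p.@[v] = 0) -> p = 0.
Proof.
move=> charK p0; pose B := msize p.
(* Kronecker substitution: distinct monomials of p keep distinct exponents. *)
pose code (m : 'X_{1..k}) := (\sum_i m i * B ^ i)%N.
have codeB m : m \in msupp p -> forall i, (m i < B)%N.
  move=> /msize_mdeg_lt lt_m i; apply: leq_ltn_trans lt_m.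
  by rewrite mdegE (bigD1 i) //= leq_addr.
pose q : {poly K} := \sum_(m <- msupp p) p@_m *: 'X^(code m).
have q0 : q = 0.
  apply: poly_vanish => // t; rewrite -(p0 (fun i => t ^+ (B ^ i))) mevalE horner_sum.
  apply: eq_bigr => m _; rewrite hornerZ hornerXn /code expr_sum; congr (_ * _).
  by apply: eq_bigr => i _; rewrite mulnC exprM.
apply/mpolyP => m; rewrite mcoeff0; apply/eqP/negP => /negP; rewrite -mcoeff_msupp => m_p.
have := congr1 (fun r : {poly K} => r`_(code m)) q0.
rewrite coef0 coef_sum (bigD1_seq m) //= ?msupp_uniq // coefZ coefXn eqxx mulr1.
rewrite big_seq_cond big1 ?addr0 => [/eqP|m' /andP[m'_p ne]].
  by rewrite -[_ == 0]negbK -mcoeff_msupp m_p.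
rewrite coefZ coefXn; case: eqP => [e|]; last by rewrite mulr0.
case/negP: ne; apply/eqP/mnmP => i.
by apply: (@sum_expn_inj B k m' m) => //; apply: codeB.
Qed.

(** On each line through 0 the polynomial has no root over the closed field, hence is constant; so
    its value at every [v] is its value at 0. *)
Lemma mpoly_nonvanish (K : closedFieldType) (k : nat) (p : {mpoly K[k]}) :
  [pchar K] =i pred0 -> (forall v, p.@[v] != 0) -> p = (p@_0%MM)%:MP.
Proof.
move=> charK nz; pose r v : {poly K} := mmap polyC (fun i => v i *: 'X) p.
have rE v t : (r v).[t] = p.@[fun i => t * v i].
  rewrite -[(r v).[t]]/(horner_eval t (r v)) (rmorph_mmap (horner_eval t) polyC).
  apply: eq_mmap => [c|i] /=; rewrite /horner_eval ?hornerC //.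
  by rewrite hornerZ hornerX mulrC.
have pv v : p.@[v] = p.@[fun _ => 0].
  have s1 : size (r v) == 1%N.
    by apply/negPn/negP => /closed_rootP[t]; rewrite /root rE (negPf (nz _)).
  have [c _ rc] := size_poly1P _ s1.
  transitivity (r v).[1]; first by rewrite rE; apply: meval_eq => i; rewrite mul1r.
  transitivity (r v).[0]; first by rewrite rc !hornerC.
  by rewrite rE; apply: meval_eq => i; rewrite mul0r.
have pE : p = (p.@[fun _ => 0])%:MP.
  apply/eqP; rewrite -subr_eq0; apply/eqP/mpoly_vanish => // v.
  by rewrite mevalB mevalC pv subrr.
by rewrite {1}pE [in RHS]pE mcoeffC eqxx mulr1.
Qed.

(** * Specialization to finite fields *)

(** The first clause makes [psi] factor through the image of [phi], so that equations valid in [C]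
    pass to [F]; stating it with kernels avoids forming that subring. *)
Definition specializable (U : comNzRingType) (C : fieldType) (phi : {rmorphism U -> C}) :=
  forall q, phi q != 0 ->
  exists (F : finFieldType) (psi : {rmorphism U -> F}),
    (forall p, phi p = 0 -> psi p = 0) /\ psi q != 0.

(** Reduction modulo a prime larger than [|q|]. *)
Lemma specializable_int (C : fieldType) (phi : {rmorphism int -> C}) :
  [pchar C] =i pred0 -> specializable phi.
Proof.
move=> /pcharf0P charC q q0.
have phiE z : phi z = z%:~R by rewrite -[in LHS](intz z) rmorph_int.
have absE (z : int) (K : fieldType) : ((z%:~R : K) == 0) = ((`|z|%N)%:R == 0 :> K).
  by case: z => k //=; rewrite NegzE mulrNz oppr_eq0.
have [p p_gt p_pr] := prime_above `|q|%N.
exists 'F_p, (GRing.RMorphism.clone _ _ (intmul 1 : int -> 'F_p) _).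
split=> [r|] /=.
  by move/eqP; rewrite phiE absE charC absz_eq0 => /eqP ->.
move: q0; rewrite phiE absE charC -lt0n => q_gt0.
rewrite absE -(dvdn_pcharf (pchar_Fp p_pr)).
by apply: contraL p_gt => p_dvd; rewrite -leqNgt dvdn_leq.
Qed.

Lemma finField_root (F : finFieldType) (p : {poly F}) : (1 < size p)%N ->
  exists (L : finFieldType) (i : {rmorphism F -> L}) (b : L), root (map_poly i p) b.
Proof.
move=> p_gt1; have p_neq0: p != 0 by rewrite -size_poly_gt0 ltnW.
have [L [rs eq_p _]] := FinSplittingFieldFor p_neq0.
exists (FinFieldExtType L : finFieldType), (in_alg L : {rmorphism F -> L}).
case: rs eq_p => [|b rs] eq_p.
  move/eqp_size: eq_p; rewrite big_nil size_poly1 size_map_poly => s1.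
  by rewrite s1 in p_gt1.
exists b; rewrite (eqp_root eq_p) big_cons rootM.
by rewrite root_XsubC eqxx.
Qed.

Lemma ex_least (P : nat -> Prop) : (exists n, P n) ->
  exists2 n, P n & forall m, (m < n)%N -> ~ P m.
Proof.
case=> n; elim/ltn_ind: n => n IHn Pn.
case: (classic (exists2 m, (m < n)%N & P m)) => [[m lt_mn Pm]|no]; first exact: IHn Pm.
by exists n => // m lt_mn Pm; apply: no; exists m.
Qed.

Section SpecializablePoly.
Variables (U : comNzRingType) (C : fieldType) (phi : {rmorphism {poly U} -> C}).
Variables (phi0 : {rmorphism U -> C}) (phi_polyC : forall c, phi c%:P = phi0 c).

Local Notation bar := (map_poly phi0).

Let phiE p : phi p = (bar p).[phi 'X].
Proof.
elim/poly_ind: p => [|p c IHp]; first by rewrite !rmorph0 horner0.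
have -> : bar (p * 'X + c%:P) = bar p * 'X + (phi0 c)%:P.
  by rewrite rmorphD rmorphM /= map_polyX map_polyC.
by rewrite hornerMXaddC -IHp rmorphD rmorphM /= phi_polyC.
Qed.

(** The discarded coefficients lie in the kernel of [phi0]. The new leading coefficient survives in
    [C], so pseudo-division by [p'] stays meaningful there. *)
Let trunc p : exists2 p', bar p' = bar p & size p' = size (bar p).
Proof.
have s : size (\poly_(i < size (bar p)) p`_i) = size (bar p).
  have [->|nz] := eqVneq (bar p) 0; first by rewrite size_poly0 poly_def big_ord0 size_poly0.
  apply: size_poly_eq; apply: contraNneq nz => p0.
  rewrite -lead_coef_eq0 /lead_coef coef_map. rewrite p0. by apply/eqP; exact: rmorph0.
exists (\poly_(i < size (bar p)) p`_i) => //.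
apply/polyP=> i; rewrite !coef_map coef_poly.
case: ltnP => // le. rewrite raddf0.
by have := nth_default 0 le; rewrite coef_map => ->.
Qed.

Let lead_trunc (p : {poly U}) : p != 0 -> size p = size (bar p) -> phi0 (lead_coef p) != 0.
Proof.
move=> p0 s; rewrite [lead_coef p]/lead_coef s -coef_map lead_coef_eq0.
by rewrite -size_poly_eq0 -s size_poly_eq0.
Qed.

Let ker_map (S : comNzRingType) (psi : {rmorphism U -> S}) p :
  (forall u, phi0 u = 0 -> psi u = 0) -> bar p = 0 -> map_poly psi p = 0.
Proof.
move=> ker p0; apply/polyP=> i; rewrite coef0 coef_map; apply: ker.
by rewrite -coef_map p0 coef0.
Qed.

(** If [phi 'X] is transcendental over the image of [phi0], then ['X] may go to any point of a
    finite extension where [q] does not vanish. If it is algebraic, ['X] goes to a root of its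
    minimal polynomial, and a Bezout relation keeps [q] nonzero. *)
Lemma specializable_poly : specializable phi0 -> specializable phi.
Proof.
move=> spec q q0.
have bq0 : bar q != 0 by apply: contraNneq q0 => bq; rewrite phiE bq horner0.
case: (classic (exists k p, [/\ phi p = 0, bar p != 0 & size (bar p) = k])); last first.
  move=> transc.
  have bar0 p : phi p = 0 -> bar p = 0.
    move=> p0; apply/eqP/negP=> /negP np; apply: transc.
    by exists (size (bar p)), p.
  have lq0 : phi0 q`_(size (bar q)).-1 != 0.
    by rewrite -coef_map -/(lead_coef _) lead_coef_eq0.
  have [F [psi0 [ker nz]]] := spec _ lq0.
  pose qF := map_poly psi0 q.
  have qF0 : qF != 0.
    by apply: contraNneq nz => qF0; rewrite -coef_map -/qF qF0 coef0.
  (* A root of X q + 1 is not a root of q. *)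
  have r_gt1 : (1 < size ('X * qF + 1)%R)%N.
    have s : size ('X * qF) = (size qF).+1 by rewrite mulrC size_mulX.
    by rewrite size_polyDl s ?size_poly1 ltnS size_poly_gt0.
  have [L [i [b rootb]]] := finField_root r_gt1.
  exists L, (horner_eval b \o map_poly (i \o psi0) : {rmorphism {poly U} -> L}).
  split=> [p /bar0 p0|] /=.
    rewrite (_ : map_poly _ p = 0) ?rmorph0 //.
    by rewrite map_poly_comp /= (ker_map ker p0) rmorph0.
  apply: contraTneq rootb; rewrite /horner_eval map_poly_comp /= -/qF => qb0.
  by rewrite /root rmorphD rmorphM rmorph1 !hornerE qb0 mulr0 add0r oner_eq0.
case/ex_least => d [mu0 [mu0_0 bmu0 smu0]] mind.
(* mu is a minimal polynomial of phi 'X over the image of phi0, and w below a gcd of q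
   and mu up to constants; w is constant since phi q != 0. *)
have [mu bmu smu] := trunc mu0.
have {mu0_0} mu_0 : phi mu = 0 by rewrite phiE bmu -phiE.
rewrite -{}bmu in bmu0 smu0 smu.
have mu_n0 : mu != 0 by apply: contraNneq bmu0 => ->; rewrite rmorph0.
have lmu0 : phi0 (lead_coef mu) != 0 by apply: lead_trunc.
pose inI w := exists u v, bar w = bar (u * q + v * mu).
have [|e [w0 [w0_I bw0 sw0]] mine] := @ex_least (fun k => exists w,
    [/\ inI w, bar w != 0 & size (bar w) = k]).
  by exists (size (bar mu)), mu; split=> //; exists 0, 1; rewrite mul0r mul1r add0r.
have [w bw sw] := trunc w0.
have {w0_I} [u [v w_uv]] : inI w by case: w0_I => u [v uv]; exists u, v; rewrite bw.
rewrite -{}bw in bw0 sw0 sw.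
have w_n0 : w != 0 by apply: contraNneq bw0 => ->; rewrite rmorph0.
(* The pseudo-remainder of [x] by [w] is again a combination of [q] and [mu], and smaller than [w];
   by minimality it vanishes under [bar]. *)
have divw x : inI x -> exists k s, bar (lead_coef w ^+ k *: x) = bar (s * w).
  case=> ux [vx x_uv].
  exists (Pdiv.Ring.rscalp x w), (Pdiv.Ring.rdivp x w).
  set r := Pdiv.Ring.rmodp x w.
  suff r0: bar r = 0 by rewrite Pdiv.ComRing.rdivp_eq [LHS]rmorphD /= -/r r0 addr0.
  apply/eqP/negP=> /negP r_n0; apply: (mine (size (bar r))).
    rewrite -sw0 -sw; apply: leq_ltn_trans (size_poly _ _) _.
    exact: Pdiv.Ring.ltn_rmodpN0.
  exists r; split=> //.
  have rE : r = lead_coef w ^+ Pdiv.Ring.rscalp x w *: x - Pdiv.Ring.rdivp x w * w.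
    by rewrite Pdiv.ComRing.rdivp_eq addrAC subrr add0r.
  exists (lead_coef w ^+ Pdiv.Ring.rscalp x w *: ux - Pdiv.Ring.rdivp x w * u).
  exists (lead_coef w ^+ Pdiv.Ring.rscalp x w *: vx - Pdiv.Ring.rdivp x w * v).
  rewrite rE rmorphB rmorphM /= map_polyZ x_uv w_uv.
  rewrite !(rmorphD, rmorphB, rmorphM) /= !map_polyZ /= -!mul_polyC.
  by ring.
have lw0 : phi0 (lead_coef w) != 0 by apply: lead_trunc.
(* Up to constants [w] divides [q], so [phi w] is nonzero, and it divides [mu]. Then [phi] kills the
   cofactor [s], whose size is therefore at least [d], which leaves [w] no positive degree. *)
have sw1 : (size w <= 1)%N.
  have [k [s ws]] : exists k s, bar (lead_coef w ^+ k *: q) = bar (s * w).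
    by apply: divw; exists 1, 0; rewrite mul0r mul1r addr0.
  have phiw : phi w != 0.
    apply: contraNneq q0 => w0'; move: (congr1 (horner^~ (phi 'X)) ws).
    rewrite -!phiE -mul_polyC !rmorphM /= w0' mulr0 phi_polyC rmorphXn /= => /eqP.
    by rewrite mulf_eq0 expf_eq0 (negPf lw0) andbF.
  have [{}k [{}s {}ws]] : exists k s, bar (lead_coef w ^+ k *: mu) = bar (s * w).
    by apply: divw; exists 0, 1; rewrite mul0r mul1r add0r.
  have phis : phi s = 0.
    move: (congr1 (horner^~ (phi 'X)) ws).
    rewrite -!phiE -mul_polyC !rmorphM /= mu_0 mulr0 => /esym/eqP.
    by rewrite mulf_eq0 (negPf phiw) orbF => /eqP.
  move: ws; rewrite map_polyZ rmorphM /= => ws.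
  have c0 : phi0 (lead_coef w ^+ k) != 0 by rewrite rmorphXn expf_neq0.
  have bs0 : bar s != 0.
    apply/eqP=> bs; move/eqP: ws; rewrite bs mul0r scale_poly_eq0 (negPf c0).
    by rewrite (negPf bmu0).
  have sz_s : (d <= size (bar s))%N.
    by rewrite leqNgt; apply/negP=> /mind; apply; exists s.
  have := congr1 (fun p : {poly C} => size p) ws.
  have sw_gt0 : (0 < size (bar w))%N by rewrite size_poly_gt0.
  rewrite /= size_scale // smu0 size_mul // sw; move: sz_s sw_gt0.
  by move: (size (bar s)) (size (bar w)); clear; lia.
have wE : w = (lead_coef w)%:P.
  by rewrite [w in LHS](size1_polyC sw1) [in RHS](size1_polyC sw1) lead_coefC.
(* The degree of [mu] must be kept for a root to exist, and the constant [w] must stay nonzero to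
   show that [q] survives. *)
have lmw0 : phi0 (lead_coef mu * lead_coef w) != 0 by rewrite rmorphM mulf_neq0.
have [F [psi0 [ker]]] := spec _ lmw0.
rewrite rmorphM mulf_eq0 negb_or => /andP[psi_mu psi_w].
have s_mu : (1 < size (map_poly psi0 mu))%N.
  rewrite size_poly_eq // ltnNge; apply/negP=> s1.
  have muE : mu = (lead_coef mu)%:P.
    by rewrite [mu in LHS](size1_polyC s1) [in RHS](size1_polyC s1) lead_coefC.
  by move: lmu0; rewrite -phi_polyC -muE mu_0 eqxx.
have [L [i [b rootb]]] := finField_root s_mu.
pose psi : {rmorphism {poly U} -> L} := horner_eval b \o map_poly (i \o psi0).
have psiC c : psi c%:P = i (psi0 c) by rewrite /psi /= map_polyC /horner_eval hornerC.
have psi_mu0 : psi mu = 0.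
  by rewrite /psi /= /horner_eval map_poly_comp /=; apply/eqP.
have psi_bar p : bar p = 0 -> psi p = 0.
  by move=> p0; rewrite /psi /= map_poly_comp /= (ker_map ker p0) raddf0 /horner_eval horner0.
exists L, psi; split=> [p p0|].
  (* The remainder of [p] modulo [mu] is killed by [phi] and smaller than the minimal size [d], so
     [bar] kills it. *)
  have := Pdiv.ComRing.rdivp_eq mu p; set r := Pdiv.Ring.rmodp p mu => pE.
  have r0 : bar r = 0.
    apply/eqP/negP=> /negP r_n0; apply: (mind (size (bar r))).
      rewrite -smu0 -smu; apply: leq_ltn_trans (size_poly _ _) _.
      exact: Pdiv.Ring.ltn_rmodpN0.
    exists r; split=> //; move/(congr1 phi): pE.
    by rewrite -mul_polyC rmorphD !rmorphM /= p0 mu_0 !mulr0 add0r.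
  move/(congr1 psi): pE; rewrite -mul_polyC rmorphD !rmorphM psi_mu0 (psi_bar _ r0).
  rewrite mulr0 addr0 psiC.
  move/eqP.
  rewrite mulf_eq0 fmorph_eq0 rmorphXn expf_eq0 (negPf psi_mu) andbF /=.
  by move/eqP.
apply: contraNneq psi_w => psi_q.
have /psi_bar/eqP : bar (w - (u * q + v * mu)) = 0 by rewrite rmorphB /= w_uv subrr.
rewrite rmorphB rmorphD !rmorphM psi_q psi_mu0 !mulr0 addr0 subr0 [in psi w]wE psiC.
by rewrite fmorph_eq0.
Qed.

End SpecializablePoly.

(** Iterated polynomial rings suffice: the relations among the elements of [cs] are recorded only in
    the kernel of [phi']. *)
Lemma specializable_adjoin (U : comNzRingType) (C : fieldType)
    (phi : {rmorphism U -> C}) (cs : seq C) :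
  specializable phi ->
  exists (U' : comNzRingType) (i : {rmorphism U -> U'}) (phi' : {rmorphism U' -> C}),
    [/\ phi' \o i =1 phi, specializable phi' & {in cs, forall c, exists u, phi' u = c}].
Proof.
move=> spec; elim: cs => [|c cs [U' [i [phi' [phi'E spec' im]]]]].
  by exists U, (idfun : {rmorphism U -> U}), phi; split.
pose psi : {rmorphism {poly U'} -> C} := horner_eval c \o map_poly phi'.
have psiC u : psi u%:P = phi' u by rewrite /psi /= map_polyC /horner_eval hornerC.
exists {poly U'}, (polyC \o i : {rmorphism U -> {poly U'}}), psi; split.
- by move=> u /=; rewrite map_polyC /horner_eval hornerC /= -phi'E.
- exact: specializable_poly psiC spec'.
- move=> x; rewrite inE => /predU1P[-> | /im[u <-]]; last by exists u%:P.
  by exists 'X; rewrite /psi /= map_polyX /horner_eval hornerX.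
Qed.

(** * Formal inverses over a finite field *)

Section Truncation.
Variable R : comNzRingType.
Implicit Types a b : {poly R}.

(** Congruence modulo ['X^n]. Power series are represented by their truncations and compared through
    this relation. *)
Definition tcong n a b := forall i, (i < n)%N -> a`_i = b`_i.

Lemma tcong_sym n a b : tcong n a b -> tcong n b a.
Proof. by move=> e i lt; rewrite e. Qed.

Lemma tcong_trans n a b c : tcong n a b -> tcong n b c -> tcong n a c.
Proof. by move=> e e' i lt; rewrite e ?e'. Qed.

Lemma tcongD n a a' b b' : tcong n a a' -> tcong n b b' -> tcong n (a + b) (a' + b').
Proof. by move=> ea eb i lt; rewrite !coefD ea ?eb. Qed.

Lemma tcongN n a a' : tcong n a a' -> tcong n (- a) (- a').
Proof. by move=> ea i lt; rewrite !coefN ea. Qed.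

Lemma tcongM n a a' b b' : tcong n a a' -> tcong n b b' -> tcong n (a * b) (a' * b').
Proof.
move=> ea eb i lt; rewrite !coefM; apply: eq_bigr => j _.
by rewrite ea ?eb //; apply: leq_ltn_trans lt; rewrite ?leq_subr // -ltnS.
Qed.

Lemma tcong_sum n (I : Type) (r : seq I) (a b : I -> {poly R}) :
  (forall i, tcong n (a i) (b i)) -> tcong n (\sum_(i <- r) a i) (\sum_(i <- r) b i).
Proof.
by move=> e; elim/big_ind2: _ => // *; apply: tcongD.
Qed.

Lemma tcong_prod n (I : Type) (r : seq I) (a b : I -> {poly R}) :
  (forall i, tcong n (a i) (b i)) -> tcong n (\prod_(i <- r) a i) (\prod_(i <- r) b i).
Proof.
by move=> e; elim/big_ind2: _ => // *; apply: tcongM.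
Qed.

Lemma tcongX n k a b : tcong n a b -> tcong n (a ^+ k) (b ^+ k).
Proof. by move=> e; elim: k => // k IHk; rewrite !exprS; apply: tcongM. Qed.

Lemma tcong_all a b : (forall n, tcong n.+1 a b) -> a = b.
Proof. by move=> e; apply/polyP => i; apply: (e i). Qed.

Lemma tcong_mmap1 n (k : nat) (x y : 'I_k -> {poly R}) m :
  (forall i, tcong n (x i) (y i)) -> tcong n (mmap1 x m) (mmap1 y m).
Proof. by move=> e; apply: tcong_prod => i; apply: tcongX. Qed.

End Truncation.

(** A pair of points as one point, at which polynomials in [m + m] variables such as the entries of
    [adj J(X, Y)] are evaluated. *)
Definition joinf (A : Type) (m : nat) (x y : 'I_m -> A) (i : 'I_(m + m)) : A :=
  match split i with inl j => x j | inr j => y j end.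

Lemma joinf_l (A : Type) m (x y : 'I_m -> A) j : joinf x y (lshift m j) = x j.
Proof. by rewrite /joinf -[lshift m j]/(unsplit (inl j)) unsplitK. Qed.

Lemma joinf_r (A : Type) m (x y : 'I_m -> A) j : joinf x y (rshift m j) = y j.
Proof. by rewrite /joinf -[rshift m j]/(unsplit (inr j)) unsplitK. Qed.

(** In [{poly {poly R}}] the inner variable ['X%:P] is t and the outer variable ['X] is t'. Thus
    [a%:P] is a(t), [map_poly polyC b] is b(t'), and the outer index of a coefficient is the
    exponent of t'. *)
Lemma coef_bipoly (R : comNzRingType) (a b : {poly R}) i j :
  (a%:P * map_poly polyC b)`_j`_i = a`_i * b`_j.
Proof. by rewrite coefCM coef_map coefMC. Qed.

Lemma bicong_mul (R : comNzRingType) n (w u v : {poly {poly R}}) :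
  (forall j i, (j < n)%N -> (i < n)%N -> u`_j`_i = v`_j`_i) ->
  forall j i, (j < n)%N -> (i < n)%N -> (w * u)`_j`_i = (w * v)`_j`_i.
Proof.
move=> e j i jn il; rewrite !coefM !coef_sum; apply: eq_bigr => k _.
rewrite !coefM; apply: eq_bigr => l _; congr (_ * _); apply: e.
  exact: leq_ltn_trans (leq_subr _ _) jn.
exact: leq_ltn_trans (leq_subr _ _) il.
Qed.

Lemma coef_bidiff (R : comNzRingType) (c : R) (u v : {poly R}) b a :
  (c%:P%:P * (u%:P - map_poly polyC v))`_b`_a =
  c * ((if b == 0%N then u`_a else 0) - (if a == 0%N then v`_b else 0)).
Proof. by rewrite !coefCM !coefB coef_map !coefC; case: (b == 0%N); rewrite ?coef0. Qed.

Lemma coef_mulTS (R : comNzRingType) (w : {poly {poly R}}) b a :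
  (w * ('X%:P - 'X))`_b`_a =
  (if a == 0%N then 0 else w`_b`_a.-1) - (if b == 0%N then 0 else w`_b.-1`_a).
Proof.
rewrite mulrBr !coefB coefMC !coefMX; congr (_ - _).
by case: (b == 0%N); rewrite ?coef0.
Qed.

Section FormalInverse.
Variables (F : finFieldType) (m : nat) (p : 'I_m -> {mpoly F[m]}).
Variables (al : 'I_m -> 'I_m -> {mpoly F[m + m]}) (c : F).
Hypothesis c_neq0 : c != 0.
(** Here [al] and [c] stand for the adjugate and the determinant of the Jacobian. The ring [A] is
    arbitrary because the identity serves in [F[t, t']], [F[t]] and [F[t]/(g)]. *)
Hypothesis al_diff : forall (A : comNzRingType) (f : {rmorphism F -> A}) (x x' : 'I_m -> A) r,
  f c * (x r - x' r) =
  \sum_s mmap f (joinf x x') (al r s) * (mmap f x (p s) - mmap f x' (p s)).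

Variables (y0 y : 'I_m -> F) (x : nat -> 'I_m -> F).
Local Notation X K := (fun r => \poly_(k < K.+1) x k r).
Hypothesis x_sol : forall K s,
  tcong K.+1 (mmap polyC (X K) (p s)) ((y0 s)%:P + y s *: 'X).

Let lmon (z : 'X_{1..m + m}) : 'X_{1..m} := [multinom z (lshift m i) | i < m].
Let rmon (z : 'X_{1..m + m}) : 'X_{1..m} := [multinom z (rshift m i) | i < m].

Let mmap1_join (A : comNzRingType) (u v : 'I_m -> A) z :
  mmap1 (joinf u v) z = mmap1 u (lmon z) * mmap1 v (rmon z).
Proof.
rewrite /mmap1 big_split_ord /=; congr (_ * _); apply: eq_bigr => i _.
  by rewrite joinf_l mnmE.
by rewrite joinf_r mnmE.
Qed.

(** By [al_diff] and [x_sol], [c (X(t) - X(t'))] and [(t - t') W] have the same coefficients up to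
    degree [K] in t and in t'. *)
Let W K r : {poly {poly F}} :=
  \sum_s mmap (polyC \o polyC) (joinf (fun r => (X K r)%:P) (fun r => map_poly polyC (X K r)))
           (al r s) * (y s)%:P%:P.

Let WE K r i j : (W K r)`_j`_i = \sum_s \sum_(z <- msupp (al r s))
   (al r s)@_z * y s * (mmap1 (X K) (lmon z))`_i * (mmap1 (X K) (rmon z))`_j.
Proof.
rewrite /W !coef_sum; apply: eq_bigr => s _.
rewrite coefMC coefMC /mmap !coef_sum big_distrl; apply: eq_bigr => z _ /=.
rewrite mmap1_join !coefCM.
have -> : mmap1 (fun r => (X K r)%:P) (lmon z) = (mmap1 (X K) (lmon z))%:P.
  by rewrite [RHS]rmorph_prod; apply: eq_bigr => l _; rewrite rmorphXn.
have -> : mmap1 (fun r => map_poly polyC (X K r)) (rmon z) =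
    map_poly polyC (mmap1 (X K) (rmon z)).
  by rewrite [RHS]rmorph_prod; apply: eq_bigr => l _; rewrite rmorphXn.
by rewrite coef_bipoly; ring.
Qed.

(** Since (t^k - t'^k) / (t - t') is the sum of t^i t'^j over i + j = k - 1, dividing
    [c (X(t) - X(t'))] by t - t' yields a Hankel matrix. *)
Let hankelW K r i j : (i + j < K)%N -> (W K r)`_j`_i = c * x (i + j).+1 r.
Proof.
pose B : comNzRingType := {poly {poly F}}.
have cong a b : (a <= K)%N -> (b <= K)%N ->
    (c%:P%:P * ((X K r)%:P - map_poly polyC (X K r)) : B)`_b`_a =
    (W K r * ('X%:P - 'X))`_b`_a.
  move=> aK bK.
  have := al_diff (polyC \o polyC : {rmorphism F -> B})
    (fun r => (X K r)%:P) (fun r => map_poly polyC (X K r)) r.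
  rewrite /= => ->; rewrite /W big_distrl /= !coef_sum; apply: eq_bigr => s _.
  rewrite -mulrA; apply: (@bicong_mul _ K.+1) => // {aK bK} {}b {}a bK aK.
  set q := mmap polyC (X K) (p s).
  have -> : mmap (polyC \o polyC) (fun r => (X K r)%:P) (p s) = q%:P.
    by rewrite (rmorph_mmap polyC polyC).
  have -> : mmap (polyC \o polyC) (fun r => map_poly polyC (X K r)) (p s) = map_poly polyC q.
    rewrite (rmorph_mmap (map_poly polyC : {rmorphism {poly F} -> B}) polyC).
    by apply: eq_mmap => // d /=; rewrite map_polyC.
  transitivity (((y0 s)%:P + y s *: 'X)%:P - map_poly polyC ((y0 s)%:P + y s *: 'X))`_b`_a.
    rewrite !coefB !coefC !coef_map x_sol //; congr (_ - _).
      by case: eqP => // _; rewrite x_sol.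
  have -> : map_poly polyC ((y0 s)%:P + y s *: 'X) = (y0 s)%:P%:P + (y s)%:P *: 'X.
    by rewrite [LHS]raddfD /= map_polyC map_polyZ map_polyX.
  rewrite -!mul_polyC !polyCD !polyCM.
  by congr (fun w : {poly {poly F}} => w`_b`_a); ring.
have XE k : (k <= K)%N -> (X K r)`_k = x k r by move=> kK; rewrite coef_poly ltnS kK.
elim: j i => [|j IHj] i ij.
  have := cong i.+1 0%N; rewrite coef_bidiff coef_mulTS /= !subr0 XE; last by lia.
  by rewrite addn0 => <- //; lia.
(* With both exponents positive the left side has coefficient 0, so [W] is constant along
   antidiagonals. *)
have := cong i.+1 j.+1; rewrite coef_bidiff coef_mulTS /= subr0 mulr0 => e.
rewrite addnS -addSn -IHj; last by lia.
by apply/eqP; rewrite -subr_eq0 -e //; lia.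
Qed.

Variable M : nat.
(* Each monomial of al is a function of x times a function of x', so this bounds the rank
   of the Hankel matrix of the coefficients of X. *)
Hypothesis al_size : (\sum_r \sum_s size (msupp (al r s)) <= M)%N.

Let X_tcong K L r : (K <= L)%N -> tcong K.+1 (X L r) (X K r).
Proof. by move=> KL k kK; rewrite !coef_poly kK ltnS (leq_trans _ KL). Qed.

(** A Hankel matrix of rank at most [M] gives a linear recurrence with [M + 1] terms, that is, a
    denominator of degree at most [M]. *)
Lemma rational_solution : exists (h : {poly F}) (f : 'I_m -> {poly F}),
  [/\ h != 0, forall r, (size (f r) <= M.+1)%N &
      forall K r, tcong K.+1 (h * X K r) (f r)].
Proof.
pose zs := flatten [seq msupp (al rs.1 rs.2) | rs <- index_enum ('I_m * 'I_m)%type].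
have zs_size : (size zs <= M)%N.
  by apply: leq_trans al_size; rewrite size_flatten sumnE !big_map pair_bigA leqnn.
have zsP r s z : z \in msupp (al r s) -> z \in zs.
  by move=> zrs; apply/flatten_mapP; exists (r, s); rewrite ?mem_index_enum.
pose bc z j := (mmap1 (X j) (rmon z))`_j.
have bcE z j K : (j <= K)%N -> (mmap1 (X K) (rmon z))`_j = bc z j.
  by move=> jK; apply: (@tcong_mmap1 _ j.+1) => // l; apply: X_tcong.
(* There is one column for each monomial, carrying its factor in t'; [M + 1] rows force a left
   kernel vector. If [zs] is shorter than [M], the default [0%MM] fills the other columns. *)
pose Bm : 'M[F]_(M.+1, M) := \matrix_(j, k) bc (nth 0%MM zs k) j.
have [u u0 uB] : exists2 u : 'rV[F]_M.+1, u != 0 & u *m Bm = 0.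
  have : kermx Bm != 0.
    by rewrite kermx_eq0 /row_free neq_ltn ltnS rank_leq_col.
  by case/rowV0Pn => v /sub_kermxP vB v0; exists v.
have u_z z : z \in zs -> \sum_j u 0 j * bc z j = 0.
  move=> z_zs; have lt_z : (index z zs < M)%N.
    by apply: leq_trans zs_size; rewrite index_mem.
  transitivity ((u *m Bm) 0 (Ordinal lt_z)); last by rewrite uB mxE.
  by rewrite mxE; apply: eq_bigr => j _; rewrite mxE /= nth_index.
have ux i r : \sum_(j < M.+1) u 0 j * x (i + j).+1 r = 0.
  apply: (mulfI c_neq0); rewrite mulr0 mulr_sumr.
  pose K := (i + M).+1.
  transitivity (\sum_(j < M.+1) u 0 j * (W K r)`_j`_i).
    apply: eq_bigr => j _; have ijK : (i + j < K)%N by rewrite /K ltnS leq_add2l -ltnS.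
    by rewrite mulrCA (@hankelW K r i j ijK).
  under eq_bigr do rewrite WE mulr_sumr.
  rewrite exchange_big big1 //= => s _.
  under eq_bigr do rewrite mulr_sumr.
  rewrite exchange_big big1_seq //= => z /zsP/u_z zz.
  transitivity ((al r s)@_z * y s * (mmap1 (X K) (lmon z))`_i *
    \sum_(j < M.+1) u 0 j * bc z j); last by rewrite zz mulr0.
  rewrite mulr_sumr.
  apply: eq_bigr => j _; rewrite bcE; first by rewrite mulrCA.
  by rewrite /K -ltnS ltnS (leq_trans (ltnW (ltn_ord j))) // ltnS leq_addl.
(* The kernel vector reversed: for k > M, the coefficient of t^k in [h X] is the left side of the
   recurrence [ux] at i = k - M - 1. *)
pose h := \sum_(j < M.+1) u 0 j *: 'X^(M - j).
have h_coef (j : 'I_M.+1) : h`_(M - j) = u 0 j.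
  rewrite coef_sum (bigD1 j) //= coefZ coefXn eqxx mulr1 big1 ?addr0 // => k kj.
  rewrite coefZ coefXn; case: eqP => [e|]; last by rewrite mulr0.
  by case/negP: kj; apply/eqP/val_inj => /=; have := ltn_ord k; have := ltn_ord j; lia.
pose fc k r := \sum_(l < k.+1) h`_l * x (k - l) r.
have hX K k r : (k <= K)%N -> (h * X K r)`_k = fc k r.
  move=> kK; rewrite coefM; apply: eq_bigr => l _.
  by rewrite coef_poly ltnS (leq_trans (leq_subr _ _) kK).
exists h, (fun r => \poly_(k < M.+1) fc k r); split.
- apply: contraNneq u0 => h0; apply/eqP/rowP => j.
  by rewrite -h_coef h0 coef0 mxE.
- by move=> r; apply: size_poly.
- move=> K r k; rewrite ltnS => kK; rewrite hX // coef_poly ltnS.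
  case: leqP => // Mk; rewrite -(hX k) // /h mulr_suml coef_sum.
  rewrite -[RHS](ux (k - M.+1)%N r); apply: eq_bigr => j _.
  rewrite -scalerAl coefZ coefXnM; congr (_ * _).
  have := ltn_ord j => jM; rewrite ifF; last by lia.
  by rewrite coef_poly ifT; [congr (x _ r) | ]; lia.
Qed.

(* [h ^+ D] clears the denominators of [E] at [X], uniformly in the second argument. *)
Let cleared (h : {poly F}) (E : ('I_m -> {poly F}) -> ('I_m -> {poly F}) -> {poly F}) :=
  exists D, forall x', exists G, forall K, tcong K.+1 (h ^+ D * E (X K) x') G.

Let clearedM h E E' : cleared h E -> cleared h E' ->
  cleared h (fun u v => E u v * E' u v).
Proof.
move=> [D DE] [D' DE']; exists (D + D')%N => x'.
have [G GE] := DE x'; have [G' GE'] := DE' x'; exists (G * G') => K.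
by rewrite exprD mulrACA; apply: tcongM.
Qed.

Let clearedD h E E' : cleared h E -> cleared h E' ->
  cleared h (fun u v => E u v + E' u v).
Proof.
move=> [D DE] [D' DE']; exists (D + D')%N => x'.
have [G GE] := DE x'; have [G' GE'] := DE' x'.
exists (h ^+ D' * G + h ^+ D * G') => K.
rewrite mulrDr exprD {1}[h ^+ D * _]mulrC -!mulrA.
by apply: tcongD; apply: tcongM.
Qed.

Let cleared_const h (g : ('I_m -> {poly F}) -> {poly F}) : cleared h (fun _ => g).
Proof. by exists 0%N => x'; exists (g x') => K; rewrite mul1r. Qed.

(** Each coordinate of the first argument costs one factor [h], while those of the second are
    polynomials already; so the exponent does not depend on [x']. *)
Let cleared_mmap h f : (forall K r, tcong K.+1 (h * X K r) (f r)) ->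
  forall q, cleared h (fun u v => mmap polyC (joinf u v) q).
Proof.
move=> hf q; rewrite /mmap.
elim: (msupp q) => [|z zs IHzs].
  have [D DE] := cleared_const h (fun _ => 0).
  by exists D => x'; have [G GE] := DE x'; exists G => K; rewrite big_nil.
have cz : cleared h (fun u v => (q@_z)%:P * mmap1 (joinf u v) z).
  apply: clearedM; first exact: (cleared_const h (fun _ => _)).
  have cX (i : 'I_(m + m)) k : cleared h (fun u v => joinf u v i ^+ k).
    elim: k => [|k IHk].
      have [D DE] := cleared_const h (fun _ => 1).
      by exists D => x'; have [G GE] := DE x'; exists G => K; rewrite expr0.
    have ci : cleared h (fun u v => joinf u v i).
      rewrite /joinf; case: split => l; last exact: (cleared_const h (fun v => v l)).
      by exists 1%N => x'; exists (f l) => K; rewrite expr1.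
    have [D DE] := clearedM ci IHk.
    by exists D => x'; have [G GE] := DE x'; exists G => K; rewrite exprS.
  rewrite /mmap1; elim: (index_enum _) => [|i r IHr].
    have [D DE] := cleared_const h (fun _ => 1).
    by exists D => x'; have [G GE] := DE x'; exists G => K; rewrite big_nil.
  have [D DE] := clearedM (cX i (z i)) IHr.
  by exists D => x'; have [G GE] := DE x'; exists G => K; rewrite big_cons.
have [D DE] := clearedD cz IHzs.
by exists D => x'; have [G GE] := DE x'; exists G => K; rewrite big_cons.
Qed.

(* Over the finite ring F[t]/(g) the map p is injective, hence onto. *)
Let solution_modulo (g : {poly F}) : g \is monic -> (1 < size g)%N ->
  exists (x' e : 'I_m -> {poly F}), forall s,
    mmap polyC x' (p s) = (y0 s)%:P + y s *: 'X + e s * g.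
Proof.
move=> g_monic g_gt1.
pose A : finComNzRingType := {poly %/ g}.
pose iA : {rmorphism {poly F} -> A} := in_qpoly g.
pose fA : {rmorphism F -> A} := iA \o polyC.
pose Phi (v : {ffun 'I_m -> A}) : {ffun 'I_m -> A} := [ffun s => mmap fA v (p s)].
have Phi_inj : injective Phi.
  move=> v v' /ffunP eqPhi; apply/ffunP => r; apply/eqP; rewrite -subr_eq0.
  have := al_diff fA v v' r; rewrite big1 => [e|s _]; last first.
    by have := eqPhi s; rewrite !ffunE => ->; rewrite subrr mulr0.
  have := congr1 (fun w => fA c^-1 * w) e.
  by rewrite mulr0 mulrA -rmorphM mulVf // rmorph1 mul1r => ->.
have [Phi' _ PhiK] := injF_bij Phi_inj.
pose v := Phi' [ffun s => iA ((y0 s)%:P + y s *: 'X)].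
have gE : mk_monic g = g by rewrite /mk_monic g_gt1 g_monic.
pose x' r : {poly F} := val (v r).
have vE r : v r = iA (x' r).
  by apply/val_inj/esym/in_qpoly_small/size_mk_monic.
exists x', (fun s => Pdiv.Ring.rdivp (mmap polyC x' (p s)) g
                     - Pdiv.Ring.rdivp ((y0 s)%:P + y s *: 'X) g) => s.
have : iA (mmap polyC x' (p s)) = iA ((y0 s)%:P + y s *: 'X).
  have /ffunP/(_ s) := PhiK [ffun s => iA ((y0 s)%:P + y s *: 'X)].
  rewrite !ffunE -/v => <-; rewrite (rmorph_mmap iA polyC).
  by apply: eq_mmap => // r; rewrite vE.
move/(congr1 val) => /=; rewrite gE => e.
rewrite [LHS](Pdiv.RingMonic.rdivp_eq g_monic).
rewrite [V in _ = V + _](Pdiv.RingMonic.rdivp_eq g_monic) e.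
by rewrite mulrBl addrAC addrCA subrr addr0 addrC.
Qed.

Lemma formal_inverse_bounded k r : (M < k)%N -> x k r = 0.
Proof.
move=> Mk; have [h [f [h_neq0 f_size hf]]] := rational_solution.
(* The modulus has to be monic and nonconstant; the factor ['X] ensures the latter even if [h] is a
   constant. *)
pose h1 : {poly F} := (lead_coef h)^-1 *: h * 'X.
pose f1 r := (lead_coef h)^-1 *: f r * 'X.
have hf1 K s : tcong K.+1 (h1 * X K s) (f1 s).
  rewrite /h1 /f1 mulrAC -scalerAl; apply: tcongM => //.
  by rewrite -!mul_polyC; apply: tcongM => //; apply: hf.
have lh : (lead_coef h)^-1 != 0 by rewrite invr_eq0 lead_coef_eq0.
have h1_monic : h1 \is monic.
  by rewrite monicE lead_coefMX lead_coefZ mulVf // lead_coef_eq0.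
have h1_gt1 : (1 < size h1)%N.
  rewrite size_mulX ?scaler_eq0 ?negb_or ?lh // ltnS size_scale //.
  by rewrite size_poly_gt0.
have /fin_all_exists[D DE] (rs : 'I_m * 'I_m) := cleared_mmap hf1 (al rs.1 rs.2).
(* This exponent serves all entries of [al] at once; the successor makes it positive, so [h1 ^+ D1]
   is not constant. *)
pose D1 := (\max_rs D rs).+1.
have h1D_gt1 : (1 < size (h1 ^+ D1))%N.
  by rewrite -subn_gt0 subn1 size_exp muln_gt0 -subn1 subn_gt0 h1_gt1.
have [x' [e x'E]] := solution_modulo (monic_exp _ h1_monic) h1D_gt1.
have /fin_all_exists[G GE] (rs : 'I_m * 'I_m) : exists G, forall K,
    tcong K.+1 (h1 ^+ D1 * mmap polyC (joinf (X K) x') (al rs.1 rs.2)) G.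
  have [G GE] := DE rs x'.
  exists (h1 ^+ (D1 - D rs) * G) => K.
  have {1}-> : D1 = (D1 - D rs + D rs)%N.
    by rewrite subnK // /D1 leqW // leq_bigmax.
  by rewrite exprD -mulrA; apply: tcongM.
(* Modulo t^(K+1), [p(X) - p(x')] is [- e h1^D1], and [h1^D1] turns the entries of [al] at [X], [x']
   into the polynomials [G]. So [Z] is [c X]. *)
pose Z : {poly F} := c%:P * x' r - \sum_s G (r, s) * e s.
have XZ K : tcong K.+1 (c%:P * X K r) Z.
  rewrite -[_ * X K r](subrK (c%:P * x' r)) addrC /Z.
  apply: tcongD => //; rewrite -mulrBr (al_diff polyC (X K) x' r) -sumrN.
  apply: tcong_sum => s; rewrite x'E.
  apply: (@tcong_trans _ _ _ (mmap polyC (joinf (X K) x') (al r s) * - (e s * h1 ^+ D1))).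
    apply: tcongM => //; rewrite -[V in tcong _ _ V]add0r.
    rewrite -[V in tcong _ _ (V + _)](subrr ((y0 s)%:P + y s *: 'X)) opprD addrA.
    by rewrite -addrA -[V in tcong _ _ V]addrA; apply: tcongD; [apply: x_sol|].
  rewrite mulrN mulrCA; apply: tcongN.
  rewrite mulrC; apply: tcongM => //.
  by rewrite mulrC; apply: (GE (r, s)).
have hZ : h1 * Z = c%:P * f1 r.
  apply: tcong_all => K; apply: (@tcong_trans _ _ _ (h1 * (c%:P * X K r))).
    by apply: tcongM => //; apply: tcong_sym; apply: XZ.
  by rewrite mulrCA; apply: tcongM.
(* The product [h1 Z = c f1] has degree at most [M + 1], and [h1] has degree at least 1. *)
have Z_size : (size Z <= M.+1)%N.
  have [->|Z0] := eqVneq Z 0; first by rewrite size_poly0.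
  have : (size (h1 * Z)%R <= M.+2)%N.
    rewrite hZ mul_polyC; apply: leq_trans (size_scale_leq _ _) _.
    have [f0 |f0] := eqVneq ((lead_coef h)^-1 *: f r) 0.
      by rewrite /f1 f0 mul0r size_poly0.
    rewrite /f1 size_mulX // ltnS; apply: leq_trans (size_scale_leq _ _) _.
    exact: f_size.
  rewrite size_monicM //.
  by move: (size Z) (size h1) h1_gt1; clear; lia.
have := XZ k k (ltnSn k); rewrite coefCM coef_poly ltnSn.
rewrite [Z`_k]nth_default => [/eqP|]; last exact: leq_trans Z_size Mk.
by rewrite mulf_eq0 (negPf c_neq0) => /eqP.
Qed.

End FormalInverse.

Lemma tcong_sum0 (R : comNzRingType) n (I : Type) (r : seq I) (a : I -> {poly R}) :
  (forall i, tcong n (a i) 0) -> tcong n (\sum_(i <- r) a i) 0.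
Proof.
move=> a0; elim/big_ind: _ => // u v u0 v0.
by rewrite -[X in tcong _ _ X]addr0; apply: tcongD.
Qed.

(** * The noncommutative formal inverse *)

Section MatrixTruncation.
Variables (R : comNzRingType) (n : nat).
Implicit Types A B : 'M[{poly R}]_n.

Definition mcong k A B := forall a b, tcong k (A a b) (B a b).

Lemma mcong_refl k A : mcong k A A. Proof. by []. Qed.

Lemma mcong_sym k A B : mcong k A B -> mcong k B A.
Proof. by move=> e a b; apply: tcong_sym. Qed.

Lemma mcong_trans k A B D : mcong k A B -> mcong k B D -> mcong k A D.
Proof. by move=> e e' a b; apply: tcong_trans (e a b) (e' a b). Qed.

Lemma mcongW k l A B : (k <= l)%N -> mcong l A B -> mcong k A B.
Proof. by move=> kl e a b i ik; apply: e; apply: leq_trans kl. Qed.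

Lemma mcongD k A A' B B' : mcong k A A' -> mcong k B B' -> mcong k (A + B) (A' + B').
Proof. by move=> eA eB a b; rewrite !mxE; apply: tcongD. Qed.

Lemma mcongN k A A' : mcong k A A' -> mcong k (- A) (- A').
Proof. by move=> eA a b; rewrite !mxE; apply: tcongN. Qed.

Lemma mcongM k A A' B B' : mcong k A A' -> mcong k B B' -> mcong k (A *m B) (A' *m B').
Proof.
move=> eA eB a b; rewrite !mxE; apply: tcong_sum => c.
exact: tcongM.
Qed.

Lemma mcongZ k u A A' : mcong k A A' -> mcong k (u *: A) (u *: A').
Proof. by move=> eA a b; rewrite !mxE; apply: tcongM. Qed.

Lemma mcong_sum k (I : Type) (r : seq I) (A B : I -> 'M[{poly R}]_n) :
  (forall i, mcong k (A i) (B i)) -> mcong k (\sum_(i <- r) A i) (\sum_(i <- r) B i).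
Proof. by move=> e; elim/big_ind2: _ => // *; apply: mcongD. Qed.

Lemma mcong_sum0 k (I : Type) (r : seq I) (A : I -> 'M[{poly R}]_n) :
  (forall i, mcong k (A i) 0) -> mcong k (\sum_(i <- r) A i) 0.
Proof.
move=> A0; elim/big_ind: _ => // U V U0 V0.
by rewrite -[X in mcong _ _ X]addr0; apply: mcongD.
Qed.

Lemma mcong_all A B : (forall k, mcong k.+1 A B) -> A = B.
Proof. by move=> e; apply/matrixP => a b; apply: tcong_all => k; apply: e. Qed.

Lemma tcong0_mul k (u v : {poly R}) : tcong k u 0 -> tcong 1 v 0 -> tcong k.+1 (u * v) 0.
Proof.
move=> u0 v0 i; rewrite ltnS => ik; rewrite coefM coef0 big1 // => j _.
have [jk|kj] := ltnP j k; first by rewrite u0 // coef0 mul0r.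
by rewrite [v`_(i - j)]v0 ?coef0 ?mulr0 // ltnS leqn0 subn_eq0 (leq_trans ik).
Qed.

(** The orders of vanishing add: [A] contributes [k] and [B - B'] contributes 1. *)
Lemma mcong_mulr k A B B' : mcong k A 0 -> mcong 1 B B' -> mcong k.+1 (A *m B) (A *m B').
Proof.
move=> A0 BB'; rewrite -[A *m B](subrK (A *m B')) -[X in mcong _ _ X]add0r.
apply: mcongD => //; rewrite -mulmxBr => a b; rewrite !mxE.
apply: tcong_sum0 => c; apply: tcong0_mul; first by have := A0 a c; rewrite mxE.
by move=> i i1; rewrite !mxE coefB BB' // subrr coef0.
Qed.

Lemma mcong_mull k A B B' : mcong k A 0 -> mcong 1 B B' -> mcong k.+1 (B *m A) (B' *m A).
Proof.
move=> A0 BB'; rewrite -[B *m A](subrK (B' *m A)) -[X in mcong _ _ X]add0r.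
apply: mcongD => //; rewrite -mulmxBl => a b; rewrite !mxE.
apply: tcong_sum0 => c; rewrite mulrC; apply: tcong0_mul; first by have := A0 c b; rewrite mxE.
by move=> i i1; rewrite !mxE coefB BB' // subrr coef0.
Qed.

End MatrixTruncation.

(** * Homogeneous parts and Newton iteration *)

Section FormalNC.
Variables (R : comNzRingType) (N : nat).
Implicit Types p q : ncpoly R N.

Fixpoint ncsubst (g : 'I_N -> ncpoly R N) p :=
  match p with
  | NCVar i => g i
  | NCConst c => NCConst N c
  | NCAdd p q => NCAdd (ncsubst g p) (ncsubst g q)
  | NCMul p q => NCMul (ncsubst g p) (ncsubst g q)
  end.

Definition ncsum (s : seq (ncpoly R N)) := foldr (@NCAdd R N) (NCConst N 0) s.

Fixpoint cst p : R :=
  match p with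
  | NCVar _ => 0
  | NCConst c => c
  | NCAdd p q => cst p + cst q
  | NCMul p q => cst p * cst q
  end.

Fixpoint lin p (j : 'I_N) : R :=
  match p with
  | NCVar i => (i == j)%:R
  | NCConst _ => 0
  | NCAdd p q => lin p j + lin q j
  | NCMul p q => lin p j * cst q + cst p * lin q j
  end.

(* Homogeneous component of degree k. *)
Fixpoint homc p (k : nat) : ncpoly R N :=
  match p with
  | NCVar i => if k == 1%N then NCVar R i else NCConst N 0
  | NCConst c => NCConst N (if k == 0%N then c else 0)
  | NCAdd p q => NCAdd (homc p k) (homc q k)
  | NCMul p q => ncsum [seq NCMul (homc p l) (homc q (k - l)%N) | l <- iota 0 k.+1]
  end.

Section Newton.
Variables (P : 'I_N -> ncpoly R N) (Li : 'I_N -> 'I_N -> R).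

(* Newton iteration for the solution x of P(x) = P(0) + y with x(0) = 0;
   Li is the inverse of the linear part of P. *)
Fixpoint newton (k : nat) : 'I_N -> ncpoly R N :=
  match k with
  | 0 => fun _ => NCConst N 0
  | k.+1 => fun i => NCAdd (newton k i) (ncsum [seq NCMul (NCConst N (Li i j))
      (NCAdd (NCAdd (NCVar R j) (NCConst N (cst (P j))))
             (NCMul (NCConst N (-1)) (ncsubst (newton k) (P j)))) | j <- enum 'I_N])
  end.

(** Degrees up to [k] are already stable in the [k]-th iterate, so this is the part of degree [k] of
    the formal inverse. Being an expression over [R], it can be transported along ring morphisms. *)
Definition invc k i := homc (newton k i) k.

End Newton.

Lemma ev_subst n (X : 'I_N -> 'M[R]_n) g p :
  ev X (ncsubst g p) = ev (fun i => ev X (g i)) p.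
Proof. by elim: p => //= p -> q ->. Qed.

Lemma eq_subst g h p : g =1 h -> ncsubst g p = ncsubst h p.
Proof. by move=> e; elim: p => //= p -> q ->. Qed.

Lemma ev_sum n (X : 'I_N -> 'M[R]_n) s : ev X (ncsum s) = \sum_(p <- s) ev X p.
Proof.
elim: s => [|p s IHs] /=; first by rewrite big_nil; apply/matrixP => a b; rewrite !mxE mul0rn.
by rewrite IHs big_cons.
Qed.

Lemma cst_sum s : cst (ncsum s) = \sum_(p <- s) cst p.
Proof. by elim: s => [|p s IHs] /=; rewrite ?big_nil // IHs big_cons. Qed.

Lemma cst_subst g p : (forall i, cst (g i) = 0) -> cst (ncsubst g p) = cst p.
Proof. by move=> g0; elim: p => //= p -> q ->. Qed.

Lemma ev_at0 n p : ev (fun _ => 0 : 'M[R]_n) p = (cst p)%:M.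
Proof.
elim: p => [i|c|p IHp q IHq|p IHp q IHq] //=.
- by rewrite raddf0.
- by rewrite IHp IHq raddfD.
- by rewrite IHp IHq scalar_mxM.
Qed.

Lemma dd_at0 n (H : 'I_N -> 'M[R]_n) p :
  dd (fun _ => 0) (fun _ => 0) H p = \sum_j lin p j *: H j.
Proof.
elim: p => [i|c|p IHp q IHq|p IHp q IHq] /=.
- rewrite (bigD1 i) //= eqxx scale1r big1 ?addr0 // => j ji.
  by rewrite eq_sym (negPf ji) scale0r.
- by rewrite big1 // => j _; rewrite scale0r.
- by rewrite IHp IHq -big_split; apply: eq_bigr => j _; rewrite scalerDl.
- rewrite !ev_at0 IHp IHq mul_mx_scalar mul_scalar_mx !scaler_sumr -big_split.
  by apply: eq_bigr => j _; rewrite /= !scalerA -scalerDl [cst q * _]mulrC.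
Qed.

Lemma ev_cong1 n (X : 'I_N -> 'M[{poly R}]_n) p : (forall i, mcong 1 (X i) 0) ->
  mcong 1 (ev X (ncmap polyC p)) (cst p)%:P%:M.
Proof.
move=> X0; elim: p => [i|c|p IHp q IHq|p IHp q IHq] //=.
- by rewrite raddf0.
- by rewrite polyCD raddfD; apply: mcongD.
- by rewrite polyCM scalar_mxM; apply: mcongM.
Qed.

(** At points divisible by ['X] each evaluated factor is its constant term modulo ['X], and [H]
    supplies the other [k] orders; only the linear part of [p] is left. *)
Lemma dd_cong k n (X Y H : 'I_N -> 'M[{poly R}]_n) p :
  (forall i, mcong 1 (X i) 0) -> (forall i, mcong 1 (Y i) 0) ->
  (forall i, mcong k (H i) 0) ->
  mcong k.+1 (dd X Y H (ncmap polyC p)) (\sum_j (lin p j)%:P *: H j).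
Proof.
move=> X0 Y0 H0.
have lin0 q : mcong k (\sum_j (lin q j)%:P *: H j) 0.
  by apply: mcong_sum0 => j; rewrite -[X in mcong _ _ X](scaler0 _ (lin q j)%:P); apply: mcongZ.
have ddk q : mcong k.+1 (dd X Y H (ncmap polyC q)) (\sum_j (lin q j)%:P *: H j) ->
    mcong k (dd X Y H (ncmap polyC q)) 0.
  by move=> e; apply: mcong_trans (lin0 q); apply: mcongW e.
elim: p => [i|c|p IHp q IHq|p IHp q IHq] /=.
- rewrite (bigD1 i) //= eqxx scale1r big1 ?addr0 // => j ji.
  by rewrite eq_sym (negPf ji) scale0r.
- by rewrite big1 // => j _; rewrite scale0r.
- under eq_bigr do rewrite polyCD scalerDl.
  by rewrite big_split; apply: mcongD.
- under eq_bigr do rewrite polyCD !polyCM scalerDl.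
  rewrite big_split; apply: mcongD.
    apply: mcong_trans (mcong_mulr (ddk _ IHp) (ev_cong1 q Y0)) _.
    rewrite mul_mx_scalar; apply: mcong_trans (mcongZ _ IHp) _.
    by rewrite scaler_sumr; apply: mcong_sum => j; rewrite scalerA mulrC.
  apply: mcong_trans (mcong_mull (ddk _ IHq) (ev_cong1 p X0)) _.
  rewrite mul_scalar_mx; apply: mcong_trans (mcongZ _ IHq) _.
  by rewrite scaler_sumr; apply: mcong_sum => j; rewrite scalerA.
Qed.

End FormalNC.

Section FormalNaturality.
Variables (R S : comNzRingType) (f : {rmorphism R -> S}) (N : nat).
Implicit Types p q : ncpoly R N.

Lemma ncmap_sum (s : seq (ncpoly R N)) : ncmap f (ncsum s) = ncsum (map (ncmap f) s).
Proof. by elim: s => [|p s IHs] /=; rewrite ?rmorph0 // IHs. Qed.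

Lemma ncmap_subst (g : 'I_N -> ncpoly R N) p :
  ncmap f (ncsubst g p) = ncsubst (fun i => ncmap f (g i)) (ncmap f p).
Proof. by elim: p => //= p -> q ->. Qed.

Lemma cst_map p : cst (ncmap f p) = f (cst p).
Proof.
by elim: p => //= [i|p -> q ->|p -> q ->]; rewrite ?rmorph0 ?rmorphD ?rmorphM.
Qed.

Lemma lin_map p j : lin (ncmap f p) j = f (lin p j).
Proof.
elim: p => [i|c|p IHp q IHq|p IHp q IHq] /=; first by rewrite rmorph_nat.
- by rewrite rmorph0.
- by rewrite IHp IHq rmorphD.
- by rewrite IHp IHq !cst_map rmorphD !rmorphM.
Qed.

Lemma ncmap_homc p k : ncmap f (homc p k) = homc (ncmap f p) k.
Proof.
elim: p k => [i|c|p IHp q IHq|p IHp q IHq] k /=.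
- by case: eqP => //=; rewrite rmorph0.
- by case: eqP => //=; rewrite rmorph0.
- by rewrite IHp IHq.
- rewrite ncmap_sum -map_comp IHp IHq.
  by congr (NCAdd (NCMul _ _) (ncsum _)); apply: eq_map => l /=; rewrite IHp IHq.
Qed.

Lemma ncmap_newton (P : 'I_N -> ncpoly R N) (Li : 'I_N -> 'I_N -> R) k i :
  ncmap f (newton P Li k i) = newton (fun i => ncmap f (P i)) (fun i j => f (Li i j)) k i.
Proof.
elim: k i => [|k IHk] i /=; first by rewrite rmorph0.
rewrite IHk ncmap_sum -map_comp; congr (NCAdd _ (ncsum _)).
apply: eq_map => j /=; rewrite ncmap_subst cst_map rmorphN1.
by rewrite (eq_subst _ IHk).
Qed.

(** This lets the vanishing of the parts of the inverse be tested after specialization. *)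
Lemma ncmap_invc (P : 'I_N -> ncpoly R N) (Li : 'I_N -> 'I_N -> R) k i :
  ncmap f (invc P Li k i) = invc (fun i => ncmap f (P i)) (fun i j => f (Li i j)) k i.
Proof. by rewrite ncmap_homc ncmap_newton. Qed.

End FormalNaturality.

Section NewtonSolution.
Variables (R : comNzRingType) (N n : nat).
Variables (P : 'I_N -> ncpoly R N) (Li : 'I_N -> 'I_N -> R).

Lemma ev_newtonS (X : 'I_N -> 'M[R]_n) k i :
  ev X (newton P Li k.+1 i) = ev X (newton P Li k i) +
  \sum_j Li i j *: (X j + (cst (P j))%:M - ev (fun i => ev X (newton P Li k i)) (P j)).
Proof.
rewrite /= ev_sum big_map big_enum /=; congr (_ + _); apply: eq_bigr => j _.
by rewrite ev_subst !mul_scalar_mx scaleN1r.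
Qed.

Lemma cst_newton k i : cst (newton P Li k i) = 0.
Proof.
elim: k i => [|k IHk] i //=; rewrite IHk add0r cst_sum big_map big1 // => j _ /=.
by rewrite cst_subst // add0r mulN1r subrr mulr0.
Qed.

End NewtonSolution.

Section NewtonConvergence.
Variables (R : comNzRingType) (N n : nat).
Variables (P : 'I_N -> ncpoly R N) (Li : 'I_N -> 'I_N -> R).
Hypothesis linK : forall s j, \sum_i lin (P s) i * Li i j = (s == j)%:R.
Variable Y : 'I_N -> 'M[R]_n.

(** The variable ['X] keeps track of the noncommutative degree. *)
Let tY i : 'M[{poly R}]_n := 'X *: map_mx polyC (Y i).
Let G k i := ev tY (ncmap polyC (newton P Li k i)).

Let tY0 i : mcong 1 (tY i) 0.
Proof. by move=> a b [|//] _; rewrite !mxE coefXM coef0. Qed.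

Let G0 k i : mcong 1 (G k i) 0.
Proof. by have := ev_cong1 (newton P Li k i) tY0; rewrite cst_newton polyC0 raddf0. Qed.

Let GS k i : G k.+1 i = G k i + \sum_j (Li i j)%:P *:
  (tY j + (cst (P j))%:P%:M - ev (G k) (ncmap polyC (P j))).
Proof.
rewrite /G !ncmap_newton ev_newtonS; congr (_ + _); apply: eq_bigr => j _.
rewrite cst_map; congr (_ *: (_ - _)); apply: eq_ev => l.
by rewrite ncmap_newton.
Qed.

(** If the error [E] has order [k + 1], the correction [Li E] changes the value of [P] by
    [lin Li E = E] up to order [k + 2]; each step gains one order. *)
Let newton_sol k s :
  mcong k.+1 (ev (G k) (ncmap polyC (P s))) ((cst (P s))%:P%:M + tY s).
Proof.
elim: k s => [|k IHk] s.
  apply: mcong_trans (ev_cong1 (P s) (G0 0)) _.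
  by rewrite -[X in mcong _ X]addr0; apply: mcongD => //; apply: mcong_sym.
rewrite -[ev _ _](subrK (ev (G k) (ncmap polyC (P s)))) -dd_sub.
pose E j := tY j + (cst (P j))%:P%:M - ev (G k) (ncmap polyC (P j)).
have E0 j : mcong k.+1 (E j) 0.
  by rewrite -[0](subrr (tY j + (cst (P j))%:P%:M)); apply: mcongD => //;
     apply: mcongN; rewrite addrC.
have dG j : G k.+1 j - G k j = \sum_l (Li j l)%:P *: E l by rewrite GS addrC addKr.
have dG0 j : mcong k.+1 (G k.+1 j - G k j) 0.
  rewrite dG; apply: mcong_sum0 => l.
  by rewrite -[X in mcong _ _ X](scaler0 _ (Li j l)%:P); apply: mcongZ.
have := dd_cong (P s) (G0 k.+1) (G0 k) dG0.
have -> : \sum_j (lin (P s) j)%:P *: (G k.+1 j - G k j) = E s.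
  under eq_bigr do rewrite dG scaler_sumr.
  rewrite exchange_big /= (bigD1 s) //= [X in _ + X]big1 ?addr0.
    under eq_bigr do rewrite scalerA -polyCM.
    by rewrite -scaler_suml -raddf_sum linK eqxx scale1r.
  move=> l ls; under eq_bigr do rewrite scalerA -polyCM.
  by rewrite -scaler_suml -raddf_sum linK eq_sym (negPf ls) raddf0 scale0r.
move=> e; have := mcongD e (@mcong_refl _ _ k.+2 (ev (G k) (ncmap polyC (P s)))).
by rewrite /E subrK [tY s + _]addrC.
Qed.

Let newton_stable k K i : (k <= K)%N -> mcong k.+1 (G K i) (G k i).
Proof.
elim: K => [|K IHK]; first by rewrite leqn0 => /eqP ->.
rewrite leq_eqVlt => /predU1P[-> //|]; rewrite ltnS => kK.
apply: mcong_trans (IHK kK); rewrite GS -[X in mcong _ _ X]addr0.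
apply: mcongD => //; apply: mcong_sum0 => l.
rewrite -[X in mcong _ _ X](scaler0 _ (Li i l)%:P); apply: mcongZ.
apply: (@mcongW _ _ _ K.+1) => //.
rewrite -[0](subrr (tY l + (cst (P l))%:P%:M)); apply: mcongD => //.
by apply: mcongN; rewrite addrC.
Qed.

Lemma coef_homc p k a b :
  (ev tY (ncmap polyC p) a b)`_k = ev Y (homc p k) a b.
Proof.
elim: p k a b => [i|c|p IHp q IHq|p IHp q IHq] k a b.
- by case: k => [|[|k]] /=; rewrite !mxE coefXM /= ?coefC ?mul0rn.
- by rewrite /= !mxE; case: (a == b); rewrite ?mulr1n ?mulr0n ?coefC ?coef0; case: k.
- by rewrite /= !mxE coefD IHp IHq.
- have -> : homc (NCMul p q) k =
      ncsum [seq NCMul (homc p l) (homc q (k - l)%N) | l <- iota 0 k.+1] by [].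
  rewrite ev_sum big_map !mxE coef_sum summxE.
  under eq_bigr do rewrite coefM.
  rewrite exchange_big -[iota 0 k.+1]/(index_iota 0 k.+1) big_mkord.
  apply: eq_bigr => l _ /=; rewrite mxE; apply: eq_bigr => c _.
  by rewrite IHp IHq.
Qed.

Definition invsum K i : 'M[{poly R}]_n :=
  \matrix_(a, b) \poly_(k < K.+1) ev Y (invc P Li k i) a b.

Let invsumE K i : mcong K.+1 (invsum K i) (G K i).
Proof.
move=> a b k kK; rewrite mxE coef_poly kK -coef_homc.
by rewrite -/(G k i) (@newton_stable k K i kK).
Qed.

Lemma ev_cong k (X X' : 'I_N -> 'M[{poly R}]_n) q :
  (forall i, mcong k (X i) (X' i)) -> mcong k (ev X q) (ev X' q).
Proof.
move=> e; elim: q => [i|c|p IHp q IHq|p IHp q IHq] //=.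
  exact: mcongD.
exact: mcongM.
Qed.

Lemma invsum_sol K s : mcong K.+1 (ev (invsum K) (ncmap polyC (P s)))
  ((cst (P s))%:P%:M + 'X *: map_mx polyC (Y s)).
Proof.
apply: (@mcong_trans _ _ _ _ (ev (G K) (ncmap polyC (P s)))); last exact: newton_sol.
by apply: ev_cong => i; apply: invsumE.
Qed.

End NewtonConvergence.

(** * The Jacobian matrix and the bound on the degree of the inverse *)

Section Coordinates.
Variables (N n : nat).

Definition dim := #|{: 'I_N * ('I_n * 'I_n)}|.

Definition coord (R : Type) (X : 'I_N -> 'M[R]_n) (r : 'I_dim) : R :=
  X (enum_val r).1 (enum_val r).2.1 (enum_val r).2.2.

Definition tup (R : Type) (x : 'I_dim -> R) (i : 'I_N) : 'M[R]_n :=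
  \matrix_(a, b) x (enum_rank (i, (a, b))).

Lemma coord_tup (R : Type) (x : 'I_dim -> R) : coord (tup x) =1 x.
Proof.
move=> r; rewrite /coord mxE; congr x.
by rewrite -[RHS]enum_valK; case: (enum_val r) => i [a b].
Qed.

Lemma tup_coord (R : Type) (X : 'I_N -> 'M[R]_n) : tup (coord X) =1 X.
Proof. by move=> i; apply/matrixP => a b; rewrite mxE /coord enum_rankK. Qed.

Lemma coord_rank (R : Type) (X : 'I_N -> 'M[R]_n) i a b :
  coord X (enum_rank (i, (a, b))) = X i a b.
Proof. by rewrite /coord enum_rankK. Qed.

Lemma eq_tup (R : Type) (x y : 'I_dim -> R) : x =1 y -> tup x =1 tup y.
Proof. by move=> e i; apply/matrixP => a b; rewrite !mxE. Qed.

Lemma map_tup (R S : Type) (f : R -> S) (x : 'I_dim -> R) i :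
  map_mx f (tup x i) = tup (f \o x) i.
Proof. by apply/matrixP => a b; rewrite !mxE. Qed.

Definition unit_tup (R : comNzRingType) (s : 'I_dim) : 'I_N -> 'M[R]_n :=
  tup (fun s' => (s' == s)%:R).

Lemma tup_sum (R : comNzRingType) (x : 'I_dim -> R) i :
  tup x i = \sum_s x s *: unit_tup R s i.
Proof.
apply/matrixP => a b; rewrite summxE !mxE (bigD1 (enum_rank (i, (a, b)))) //=.
rewrite !mxE eqxx mulr1 big1 ?addr0 // => s ne.
by rewrite !mxE eq_sym (negPf ne) mulr0.
Qed.

Section Jacobian.
Variable R : comNzRingType.
Variable P : 'I_N -> ncpoly R N.

Definition jac (X Y : 'I_N -> 'M[R]_n) : 'M[R]_dim :=
  \matrix_(r, s) coord (fun i => dd X Y (unit_tup R s) (P i)) r.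

Lemma dd_jac X Y (h : 'I_dim -> R) r :
  coord (fun i => dd X Y (tup h) (P i)) r = \sum_s jac X Y r s * h s.
Proof.
rewrite /coord (@eq_dd _ _ _ X X Y Y _ (fun i => \sum_s h s *: unit_tup R s i)) //; last first.
  by move=> i; rewrite tup_sum.
by rewrite dd_sum summxE; apply: eq_bigr => s _; rewrite !mxE mulrC.
Qed.

Lemma jac_diff (x y : 'I_dim -> R) r :
  \sum_s jac (tup x) (tup y) r s * (x s - y s) =
  coord (fun i => ev (tup x) (P i)) r - coord (fun i => ev (tup y) (P i)) r.
Proof.
rewrite -dd_jac /coord -[RHS]opprK opprB.
transitivity ((dd (tup x) (tup y) (fun i => tup x i - tup y i) (P (enum_val r).1))
  (enum_val r).2.1 (enum_val r).2.2).
  congr (fun_of_matrix _ _ _); apply: eq_dd => // i.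
  by apply/matrixP => a b; rewrite !mxE.
by rewrite dd_sub !mxE opprB.
Qed.

(** Multiplication of [jac_diff] by the adjugate. This identity provides the hypothesis
    [al_diff]. *)
Lemma adj_jac_diff (x y : 'I_dim -> R) r :
  \det (jac (tup x) (tup y)) * (x r - y r) =
  \sum_s (\adj (jac (tup x) (tup y))) r s *
    (coord (fun i => ev (tup x) (P i)) s - coord (fun i => ev (tup y) (P i)) s).
Proof.
under eq_bigr do rewrite -jac_diff.
pose d : 'cV[R]_dim := \col_s (x s - y s).
have := congr1 (fun A : 'M_dim => (A *m d) r 0) (mul_adj_mx (jac (tup x) (tup y))).
rewrite -mulmxA mul_scalar_mx mxE [RHS]mxE [d r 0]mxE => <-.
apply: eq_bigr => s _; rewrite [(jac _ _ *m d) s 0]mxE; congr (_ * _).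
by apply: eq_bigr => l _; rewrite [d l 0]mxE.
Qed.

End Jacobian.

Lemma eq_jac (R : comNzRingType) (P P' : 'I_N -> ncpoly R N) X Y :
  P =1 P' -> jac P X Y = jac P' X Y.
Proof. by move=> e; apply/matrixP => r s; rewrite !mxE /coord e. Qed.

(** * Generic matrices and base change *)

Section Generic.
Variable U : comNzRingType.
Variable P : 'I_N -> ncpoly U N.

Definition gen_ev (r : 'I_dim) : {mpoly U[dim]} :=
  coord (fun i => ev (tup (fun s => 'X_s)) (ncmap (@mpolyC dim U) (P i))) r.

(** The universal Jacobian, with the variables split as in [joinf]. Its evaluations are the
    Jacobians over all rings under [U], so its monomials can be counted once for all
    specializations. *)
Definition gen_jac : 'M[{mpoly U[dim + dim]}]_dim :=
  jac (fun i => ncmap (@mpolyC _ U) (P i))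
      (tup (fun s => 'X_(lshift dim s))) (tup (fun s => 'X_(rshift dim s))).

Lemma mmapXi k (A : comNzRingType) (f : {rmorphism U -> A}) (h : 'I_k -> A) i :
  mmap f h 'X_i = h i.
Proof. by rewrite mmapX mmap1U. Qed.

Variables (A : comNzRingType) (f : {rmorphism U -> A}).

Lemma ncmap_mmap k (h : 'I_k -> A) p :
  ncmap (mmap f h) (ncmap (@mpolyC k U) p) = ncmap (N := N) f p.
Proof. by rewrite ncmap_comp; apply: eq_ncmap => c /=; rewrite mmapC. Qed.

Lemma mmap_gen_ev x r :
  mmap f x (gen_ev r) = coord (fun i => ev (tup x) (ncmap f (P i))) r.
Proof.
pose g : {rmorphism {mpoly U[dim]} -> A} := mmap f x.
transitivity ((map_mx g (ev (tup (fun s => 'X_s)) (ncmap (@mpolyC dim U) (P (enum_val r).1))))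
  (enum_val r).2.1 (enum_val r).2.2); first by rewrite mxE.
rewrite -ev_map ncmap_mmap /coord; congr (fun_of_matrix _ _ _).
by apply: eq_ev => i; rewrite map_tup; apply: eq_tup => s; apply: mmapXi.
Qed.

Lemma mmap_gen_jac x y :
  map_mx (mmap f (joinf x y)) gen_jac = jac (fun i => ncmap f (P i)) (tup x) (tup y).
Proof.
pose g : {rmorphism {mpoly U[dim + dim]} -> A} := mmap f (joinf x y).
apply/matrixP => r s; rewrite !mxE.
transitivity ((map_mx g (dd (tup (fun s => 'X_(lshift dim s))) (tup (fun s => 'X_(rshift dim s)))
   (unit_tup {mpoly U[dim + dim]} s) (ncmap (@mpolyC _ U) (P (enum_val r).1))))
  (enum_val r).2.1 (enum_val r).2.2); first by rewrite mxE.
rewrite -dd_map ncmap_mmap /coord; congr (fun_of_matrix _ _ _).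
apply: eq_dd => i; rewrite map_tup; apply: eq_tup => l /=.
- by rewrite /g mmapXi joinf_l.
- by rewrite /g mmapXi joinf_r.
- by rewrite rmorph_nat.
Qed.

Lemma mmap_gen_det x y : mmap f (joinf x y) (\det gen_jac) =
  \det (jac (fun i => ncmap f (P i)) (tup x) (tup y)).
Proof. by rewrite -mmap_gen_jac det_map_mx. Qed.

Lemma mmap_gen_adj x y r s : mmap f (joinf x y) ((\adj gen_jac) r s) =
  (\adj (jac (fun i => ncmap f (P i)) (tup x) (tup y))) r s.
Proof. by rewrite -mmap_gen_jac -map_mx_adj [RHS]mxE. Qed.

End Generic.

End Coordinates.

Lemma joinfE (A : Type) m (v : 'I_(m + m) -> A) :
  v =1 joinf (fun i => v (lshift m i)) (fun i => v (rshift m i)).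
Proof. by move=> i; rewrite -[i]splitK; case: (split i) => j; rewrite ?joinf_l ?joinf_r. Qed.

(** Coefficients may die under [f] but none appear, so a count made before specialization bounds the
    count in every finite field. *)
Lemma size_msupp_map k (R S : comNzRingType) (f : {rmorphism R -> S}) (p : {mpoly R[k]}) :
  (size (msupp (map_mpoly f p)) <= size (msupp p))%N.
Proof.
apply: uniq_leq_size; first exact: msupp_uniq.
move=> z; rewrite !mcoeff_msupp mcoeff_map_mpoly; apply: contraNneq => ->.
by rewrite raddf0.
Qed.

Lemma eq_newton (R : comNzRingType) N (P P' : 'I_N -> ncpoly R N) Li Li' k i :
  P =1 P' -> Li =2 Li' -> newton P Li k i = newton P' Li' k i.
Proof.
move=> eP eLi; elim: k i => //= k IHk i; rewrite IHk; congr (NCAdd _ (ncsum _)).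
by apply: eq_map => j; rewrite eLi !eP (eq_subst _ IHk).
Qed.

Section InverseBound.
Variables (C : numClosedFieldType) (N : nat) (P : 'I_N -> ncpoly C N).
Hypothesis dd_inj : forall n (X Y H : 'I_N -> 'M[C]_n),
  (forall i, dd X Y H (P i) = 0) -> forall i, H i = 0.

Let charC : [pchar C] =i pred0. Proof. exact: pchar_num. Qed.

Let L : 'M[C]_N := \matrix_(s, i) lin (P s) i.

(** A kernel vector would be a tuple of 1 x 1 matrices killed by the derivative at 0. *)
Let L_unit : L \in unitmx.
Proof.
rewrite unitmxE unitfE; apply/negP => /eqP/eqP; rewrite -det_tr => /det0P[v v0 vL].
have : forall i, (v 0 i)%:M = 0 :> 'M[C]_1.
  apply: (dd_inj (X := fun _ => 0) (Y := fun _ => 0)) => s.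
  rewrite dd_at0; apply/matrixP => a b; rewrite summxE [RHS]mxE.
  transitivity ((v *m L^T) 0 s); last by rewrite vL mxE.
  rewrite mxE; apply: eq_bigr => j _.
  by rewrite !mxE !ord1 eqxx mulr1n mulrC.
move=> v_0; case/negP: v0; apply/eqP/rowP => i.
by have /matrixP/(_ 0 0) := v_0 i; rewrite !mxE eqxx mulr1n.
Qed.

Definition lininv (i j : 'I_N) : C := invmx L i j.

Lemma lininvK s j : \sum_i lin (P s) i * lininv i j = (s == j)%:R.
Proof.
have /matrixP/(_ s j) := mulmxV L_unit; rewrite !mxE => <-.
by apply: eq_bigr => i _; rewrite mxE.
Qed.

Let jac_unit n (x y : 'I_(dim N n) -> C) : \det (jac P (tup x) (tup y)) != 0.
Proof.
apply/negP; rewrite -det_tr => /det0P[v v0 vJ].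
have H0 : forall i, tup (fun s => v 0 s) i = 0.
  apply: (dd_inj (X := tup x) (Y := tup y)) => i.
  apply/matrixP => a b; rewrite [RHS]mxE.
  rewrite -(coord_rank (fun i => dd (tup x) (tup y) (tup (fun s => v 0 s)) (P i)) i a b).
  rewrite dd_jac; transitivity ((v *m (jac P (tup x) (tup y))^T) 0 (enum_rank (i, (a, b)))).
    by rewrite mxE; apply: eq_bigr => s _; rewrite [in RHS]mxE mulrC.
  by rewrite vJ mxE.
case/negP: v0; apply/eqP/rowP => s; rewrite mxE -[LHS](coord_tup (fun s => v 0 s)).
by rewrite /coord H0 mxE.
Qed.

Fixpoint consts (p : ncpoly C N) : seq C :=
  match p with
  | NCVar _ => [::]
  | NCConst c => [:: c]
  | NCAdd p q => consts p ++ consts q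
  | NCMul p q => consts p ++ consts q
  end.

Lemma ncmap_lift (U : Type) (f : U -> C) p :
  {in consts p, forall c, exists u, f u = c} -> exists q, ncmap f q = p.
Proof.
elim: p => [i|c|p IHp q IHq|p IHp q IHq] /= im.
- by exists (NCVar U i).
- by have [|u <-] := im c; [rewrite inE | exists (NCConst N u)].
- have [p' <-] : exists p', ncmap f p' = p by apply: IHp => c cp; apply: im; rewrite mem_cat cp.
  have [q' <-] : exists q', ncmap f q' = q.
    by apply: IHq => c cq; apply: im; rewrite mem_cat cq orbT.
  by exists (NCAdd p' q').
- have [p' <-] : exists p', ncmap f p' = p by apply: IHp => c cp; apply: im; rewrite mem_cat cp.
  have [q' <-] : exists q', ncmap f q' = q.
    by apply: IHq => c cq; apply: im; rewrite mem_cat cq orbT.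
  by exists (NCMul p' q').
Qed.

(** A nonzero entry at some [Y] would survive in a finite field, where [formal_inverse_bounded]
    excludes it. *)
Lemma invc_bounded n : exists M, forall k i (Y : 'I_N -> 'M[C]_n),
  (M < k)%N -> ev Y (invc P lininv k i) = 0.
Proof.
pose phiZ : {rmorphism int -> C} := intmul 1.
pose cs := flatten [seq consts (P i) | i <- enum 'I_N] ++
           [seq lininv ij.1 ij.2 | ij <- enum {: 'I_N * 'I_N}].
(* The image of [phi] contains all coefficients of [P] and of the inverse of its linear part. *)
have [U [_ [phi [_ spec im]]]] := specializable_adjoin cs (specializable_int (phi := phiZ) charC).
have /fin_all_exists[PU PUE] i : exists q, ncmap phi q = P i.
  apply: ncmap_lift => c ci; apply: im; rewrite mem_cat; apply/orP; left.
  by apply/flatten_mapP; exists i; rewrite ?mem_enum.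
have /fin_all_exists[LU LUE] (ij : 'I_N * 'I_N) : exists u, phi u = lininv ij.1 ij.2.
  apply: im; rewrite mem_cat; apply/orP; right.
  by apply/mapP; exists ij; rewrite ?mem_enum.
pose J := gen_jac n PU; pose al := \adj J.
exists (\sum_r \sum_s size (msupp (al r s))) => k i Y Mk.
(* Over [C] the determinant vanishes nowhere, hence is constant; over [U] its other coefficients are
   only known to lie in the kernel of [phi]. *)
have phi_det : map_mpoly phi (\det J) = (phi (\det J)@_0%MM)%:MP.
  rewrite -mcoeff_map_mpoly; apply: mpoly_nonvanish => // v.
  rewrite /meval mmap_map.
  rewrite (eq_mmap _ (g := phi) (fun c => erefl) (joinfE v)) mmap_gen_det.
  by rewrite (eq_jac _ _ PUE) jac_unit.
have phi_det0 : phi (\det J)@_0%MM != 0.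
  have := @jac_unit n (fun _ => 0) (fun _ => 0).
  rewrite -(eq_jac _ _ PUE) -mmap_gen_det.
  rewrite -(eq_mmap _ (f := idfun \o phi) (fun c => erefl) (fun c => erefl)) -mmap_map.
  by rewrite phi_det mmapC.
apply/matrixP => a b; rewrite [RHS]mxE; apply/eqP/negP => /negP nz.
(* The entries of [Y] are adjoined only now, after the bound has been fixed, which makes the bound
   uniform in [Y]. *)
have [U' [io [phi' [phi'E spec' im']]]] :=
  specializable_adjoin [seq coord Y r | r <- enum 'I_(dim N n)] spec.
have /fin_all_exists[yU yUE] r : exists u, phi' u = coord Y r.
  by apply: im'; apply: map_f; rewrite mem_enum.
pose gU := invc PU (fun i j => LU (i, j)) k i.
pose u := ev (tup yU) (ncmap io gU) a b.
have phi_u : phi' u = ev Y (invc P lininv k i) a b.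
  transitivity (map_mx phi' (ev (tup yU) (ncmap io gU)) a b); first by rewrite mxE.
  rewrite -ev_map ncmap_comp (eq_ncmap gU phi'E) ncmap_invc /invc.
  rewrite (@eq_newton _ _ _ P _ lininv k i PUE (fun i j => LUE (i, j))).
  congr (fun_of_matrix _ _ _); apply: eq_ev => l; rewrite map_tup -[RHS]tup_coord.
  exact: eq_tup.
(* Specializing with respect to the product keeps both the constant determinant and the entry [u]
   nonzero in [F]. *)
have [|F [psi' [ker]]] := spec' (io (\det J)@_0%MM * u).
  rewrite rmorphM phi_u mulf_neq0 //.
  by rewrite -[phi' _]/((phi' \o io) _) phi'E.
rewrite rmorphM mulf_eq0 negb_or => /andP[psi_det psi_u].
pose psi : {rmorphism U -> F} := psi' \o io.
have ker_psi v : phi v = 0 -> psi v = 0.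
  by move=> v0; apply: ker; rewrite -[phi' _]/((phi' \o io) _) phi'E.
have psi_detE : map_mpoly psi (\det J) = (psi (\det J)@_0%MM)%:MP.
  apply/mpolyP => z; rewrite mcoeff_map_mpoly mcoeffC.
  have [->|z0] := eqVneq z 0%MM; first by rewrite mulr1.
  rewrite mulr0; apply: ker_psi.
  by rewrite -mcoeff_map_mpoly phi_det mcoeffC (negPf z0) mulr0.
pose PF i := ncmap psi (PU i); pose LF i j := psi (LU (i, j)).
(* The identity [lininvK] is a relation in [C] between images of elements of [U], so it passes to
   [F]. *)
have linKF s j : \sum_i lin (PF s) i * LF i j = (s == j)%:R.
  apply/eqP; rewrite -subr_eq0; apply/eqP.
  transitivity (psi (\sum_i lin (PU s) i * LU (i, j) - (s == j)%:R)).
    rewrite rmorphB rmorph_sum rmorph_nat; congr (_ - _); apply: eq_bigr => l _.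
    by rewrite rmorphM lin_map.
  apply: ker_psi; rewrite rmorphB rmorph_sum rmorph_nat -lininvK.
  apply/eqP; rewrite subr_eq0; apply/eqP; apply: eq_bigr => l _.
  by rewrite rmorphM -lin_map PUE LUE.
pose YF := tup (psi' \o yU).
pose x k r := coord (fun i => ev YF (invc PF LF k i)) r.
have : x k (enum_rank (i, (a, b))) = 0.
  (* In coordinates, the parts of the inverse at [YF] are the coefficients of the formal solution
     with [y0 = P(0)] and [y = YF]. *)
  apply: (@formal_inverse_bounded F (dim N n) (fun r => map_mpoly psi (gen_ev PU r))
    (fun r s => map_mpoly psi (al r s)) (psi (\det J)@_0%MM) psi_det _
    (coord (fun i => (cst (PF i))%:M)) (coord YF) x _ _ _ _ _ Mk).
  - move=> A f z z' r.
    pose g : {rmorphism U -> A} := f \o psi.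
    transitivity (\det (jac (fun i => ncmap g (PU i)) (tup z) (tup z')) * (z r - z' r)).
      rewrite -(mmap_gen_det PU g z z'); congr (_ * _).
      by rewrite -[RHS](mmap_map psi f) psi_detE mmapC.
    rewrite adj_jac_diff; apply: eq_bigr => s _.
    by rewrite -(mmap_gen_adj PU g) -!(mmap_gen_ev PU g) !mmap_map.
  - move=> K s l lK.
    pose g : {rmorphism U -> {poly F}} := polyC \o psi.
    rewrite (mmap_map psi polyC) (mmap_gen_ev PU g) /coord.
    have := @invsum_sol _ _ _ _ _ linKF YF K (enum_val s).1 (enum_val s).2.1 (enum_val s).2.2 l lK.
    rewrite /PF ncmap_comp => e; transitivity ((ev (invsum PF LF YF K) (ncmap (polyC \o psi)
      (PU (enum_val s).1)) (enum_val s).2.1 (enum_val s).2.2)`_l).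
      congr (fun A : 'M[{poly F}]_n => (A (enum_val s).2.1 (enum_val s).2.2)`_l).
      apply: eq_ev => i1; apply/matrixP => a1 b1; rewrite !mxE.
      by apply/polyP => l1; rewrite !coef_poly /x coord_rank.
    rewrite e; congr (fun w : {poly F} => w`_l); rewrite !mxE -mul_polyC mulrC.
    by case: (_ == _); rewrite ?mulr1n ?mulr0n.
  - by apply: leq_sum => r _; apply: leq_sum => s _; apply: size_msupp_map.
rewrite /x coord_rank => g0; case/negP: psi_u; apply/eqP; rewrite -g0.
transitivity (map_mx psi' (ev (tup yU) (ncmap io gU)) a b); first by rewrite mxE.
rewrite -ev_map ncmap_comp -[ncmap _ gU]/(ncmap psi gU) ncmap_invc.
by congr (fun_of_matrix _ _ _); apply: eq_ev => l; rewrite map_tup.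
Qed.

End InverseBound.

(** By [invc_bounded] the formal inverse is a finite sum on matrices of size [n], so its variable t
    can be set to 1. *)
Lemma polynomial_right_inverse (C : numClosedFieldType) (N : nat) (P : 'I_N -> ncpoly C N) :
  (forall n (X Y H : 'I_N -> 'M[C]_n),
    (forall i, dd X Y H (P i) = 0) -> forall i, H i = 0) ->
  forall n, exists Q : 'I_N -> ncpoly C N,
    forall (Y : 'I_N -> 'M[C]_n) s, ev (fun i => ev Y (Q i)) (P s) = Y s.
Proof.
move=> dd_inj n; have [M bound] := invc_bounded dd_inj n.
(* The series solves [P(x) = P(0) + t y]; the shift of the argument by [- P(0)] removes the constant
   term. *)
pose sh j := NCAdd (NCVar C j) (NCConst N (- cst (P j))).
exists (fun i => ncsubst sh (ncsum [seq invc P (lininv P) k i | k <- index_iota 0 M.+1])) => Y s.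
pose Z j := ev Y (sh j).
pose S := invsum P (lininv P) Z M.
(* Truncations beyond [M] coincide, so the congruences modulo all powers of t become an equality of
   polynomials. *)
have S_stable K i : (M <= K)%N -> invsum P (lininv P) Z K i = S i.
  move=> MK; apply/matrixP => a b; rewrite !mxE; apply/polyP => k.
  rewrite !coef_poly !ltnS; case: (leqP k M) => [kM|Mk]; first by rewrite (leq_trans kM MK).
  by rewrite bound // mxE if_same.
have sol : ev S (ncmap polyC (P s)) = (cst (P s))%:P%:M + 'X *: map_mx polyC (Z s).
  apply: mcong_all => K; apply: (@mcongW _ _ _ (maxn K M).+1); first by rewrite ltnS leq_maxl.
  rewrite -(@eq_ev _ _ _ (invsum P (lininv P) Z (maxn K M))); last first.
    by move=> i; rewrite S_stable // leq_maxr.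
  exact: invsum_sol (lininvK dd_inj) _ _ _.
pose g : {rmorphism {poly C} -> C} := horner_eval 1.
have gC c : g c%:P = c by rewrite /g /= /horner_eval hornerC.
transitivity (map_mx g (ev S (ncmap polyC (P s)))).
  rewrite -ev_map ncmap_comp (_ : ncmap _ (P s) = P s); last first.
    by elim: (P s) => //= [c|p -> q ->|p -> q ->] //; rewrite gC.
  apply: eq_ev => i; rewrite ev_subst ev_sum big_map big_mkord.
  apply/matrixP => a b; rewrite summxE !mxE /g /= /horner_eval horner_poly.
  by apply: eq_bigr => k _; rewrite expr1n mulr1.
rewrite sol; apply/matrixP => a b; rewrite !mxE rmorphD rmorphM rmorphMn /= !gC.
rewrite /g /= /horner_eval hornerX mul1r /Z /= ?mxE.
case: (a == b); rewrite !(mulr1n, mulr0n); last by rewrite add0r addr0.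
by rewrite addrCA subrr addr0.
Qed.

(** * Equivalence of the four conditions *)

Lemma ncevalE (C : numClosedFieldType) (N n : nat) (X : {ffun 'I_N -> 'M[C]_n}) p :
  nceval X p = ev X p.
Proof. by elim: p => //= p -> q ->. Qed.

Lemma ncderivE (C : numClosedFieldType) (N n : nat) (X H : {ffun 'I_N -> 'M[C]_n}) p :
  ncderiv X H p = dd X X H p.
Proof. by elim: p => //= p -> q -> //; rewrite !ncevalE. Qed.

Theorem mainTheorem3 (C : numClosedFieldType) (N : nat) (P : fpmap C N) :
  let cond1 := forall (n : nat) (X H : {ffun 'I_N -> 'M[C]_n}),
      (forall i, fpderiv P X H i = 0) -> forall i, H i = 0 in
  let cond2 := forall n : nat, injective (@fpeval C N P n) in
  let cond3 := forall n : nat, bijective (@fpeval C N P n) in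
  let cond4 := forall n : nat, exists Q : fpmap C N,
      cancel (@fpeval C N P n) (@fpeval C N Q n) /\
      cancel (@fpeval C N Q n) (@fpeval C N P n) in
  [/\ cond1 <-> cond2, cond2 <-> cond3 & cond3 <-> cond4].
Proof.
move=> cond1 cond2 cond3 cond4.
have dd_inj : cond1 -> forall n (X Y H : 'I_N -> 'M[C]_n),
    (forall i, dd X Y H (P i) = 0) -> forall i, H i = 0.
  move=> c1 n X Y H H0 i.
  pose XY : {ffun 'I_N -> 'M[C]_(n + n)} := [ffun i => block_mx (X i) 0 0 (Y i)].
  pose H' : {ffun 'I_N -> 'M[C]_(n + n)} := [ffun i => block_mx 0 (H i) 0 0].
  have : H' i = 0.
    apply: (c1 _ XY) => j; rewrite ffunE ncderivE.
    rewrite (@eq_dd _ _ _ _ (fun i => block_mx (X i) 0 0 (Y i))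
      _ (fun i => block_mx (X i) 0 0 (Y i)) _ (fun i => block_mx 0 (H i) 0 0));
      do ?by move=> ?; rewrite ffunE.
    by rewrite dd_block H0 block_mx0.
  by rewrite ffunE => /(congr1 ursubmx); rewrite block_mxKur => ->;
     apply/matrixP => a b; rewrite !mxE.
have c12 : cond1 -> cond2.
  move=> c1 n X Y /ffunP PXY; apply/ffunP => i; apply/eqP; rewrite -subr_eq0; apply/eqP.
  apply: (dd_inj c1 n X Y (fun i => X i - Y i)) => j.
  by rewrite dd_sub; have := PXY j; rewrite !ffunE !ncevalE => ->; rewrite subrr.
have c21 : cond2 -> cond1.
  move=> c2 n X H H0 i.
  (* The values of [P] at [Z H] and at [Z 0] can differ only in the corner, which is the derivative;
     if it vanishes, injectivity in size [n + n] gives [H = 0]. *)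
  pose Z (K : 'I_N -> 'M[C]_n) : {ffun 'I_N -> 'M[C]_(n + n)} :=
    [ffun i => block_mx (X i) (K i) 0 (X i)].
  have ZE K j : fpeval P (Z K) j = block_mx (ev X (P j)) (dd X X K (P j)) 0 (ev X (P j)).
    rewrite ffunE ncevalE -ev_block; apply: eq_ev => l; exact: ffunE.
  have /ffunP/(_ i) : Z H = Z (fun _ => 0).
    apply: c2; apply/ffunP => j; rewrite !ZE dd0.
    by have := H0 j; rewrite ffunE ncderivE => ->.
  by rewrite !ffunE => /(congr1 ursubmx); rewrite !block_mxKur.
have c14 : cond1 -> cond4.
  move=> c1 n; have [Q QP] := polynomial_right_inverse (dd_inj c1) n.
  have QK : cancel (@fpeval C N Q n) (@fpeval C N P n).
    move=> Y; apply/ffunP => s; rewrite ffunE ncevalE -[RHS]QP.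
    by apply: eq_ev => i; rewrite ffunE ncevalE.
  (* A right inverse of an injective map is two-sided: [P(Q(P(X))) = P(X)]. *)
  by exists Q; split=> // X; apply: (c12 c1 n); rewrite QK.
have c43 : cond4 -> cond3 by move=> c4 n; have [Q [PK QK]] := c4 n; exists (@fpeval C N Q n).
have c32 : cond3 -> cond2 by move=> c3 n; apply: bij_inj.
(* The implications proved form the cycle (1), (4), (3), (2), (1). *)
split; split=> //.
- by move=> c2; apply/c43/c14/c21.
- by move=> c3; apply/c14/c21/c32.
Qed.
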